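(* Let $s,t \in T(2,1,2)$ and $k = s_{235}/s_{134}$. Then $F(G(t)) = F(G(s))$ if and only if both of the following hold: (i) $t_{ijk} = s_{ijk}$ for $(ijk) \in \{(123),(134),(235)\}$; and (ii) for every prime $p$ the tuples $(s_{124}, s_{125})$ and $(t_{124}, t_{125})$ are in the same orbit under the action of $D_k(\mathbb{Z}_p)$ on $L(t_{134}, t_{235}, t_{123})$, i.e. there is $A \in D_k(\mathbb{Z}_p)$ with $(t_{124}, t_{125})A \equiv (s_{124}, s_{125})$ modulo $(\gcd(t_{134},t_{123}), \gcd(t_{235},t_{123}))$, the two components being compared modulo $\gcd(t_{134},t_{123})\mathbb{Z}_p$ and $\gcd(t_{235},t_{123})\mathbb{Z}_p$, respectively.
   Context: For a group $G$, $F(G)$ denotes the set of isomorphism classes of finite quotients of $G$. For a prime $p$, $\mathbb{Z}_p$ denotes the $p$-adic integers. Let $\mathbb{Z}(5)$ be the set of all integer sequences $t = (t_{ijk} \in \mathbb{Z} \mid 1 \le i<j<k\le 5)$. For $t \in \mathbb{Z}(5)$ let $$G(t) = \langle g_1,\ldots,g_5 \mid [g_j,g_i] = g_{j+1}^{t_{i,j,j+1}} \cdots g_5^{t_{i,j,5}} \text{ for } 1 \le i<j\le 5\rangle$$ (empty products are trivial), where $[a,b] = a^{-1}b^{-1}ab$. For $k \in \mathbb{N}$ (positive integers) and $R \in \{\mathbb{Z}, \mathbb{Z}_p\}$ let $$D_k(R) = \left\{ \begin{pmatrix} a_{11} & a_{12} \\ a_{21} & a_{22}\end{pmatrix} \in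 \mathrm{GL}(2,R) \;\middle|\; k \mid a_{12} \text{ in } R\right\}.$$ For $a,b,c \in \mathbb{N}$ with $a \mid b$ let $L(a,b,c) = \{(x,y) \in \mathbb{N}_0^2 \mid x < \gcd(a,c),\ y < \gcd(b,c)\}$. The group $D_{b/a}(\mathbb{Z})$ acts on $L(a,b,c)$ via $(x,y) \mapsto (x,y)M \bmod (\gcd(a,c), \gcd(b,c))$, where $(x,y)M$ is the row vector times matrix product and the reduction is carried out independently in both components. For $D_{b/a}(\mathbb{Z}_p)$, two elements $(x,y),(x',y') \in L(a,b,c)$ are in the same orbit if $(x,y)M \equiv (x',y')$ componentwise modulo $(\gcd(a,c)\mathbb{Z}_p, \gcd(b,c)\mathbb{Z}_p)$ for some $M \in D_{b/a}(\mathbb{Z}_p)$. Let $O(a,b,c)$ be a (fixed) set of orbit representatives for the action of $D_{b/a}(\mathbb{Z})$ on $L(a,b,c)$. Define $$T(2,1,2) = \{ t \in \mathbb{Z}(5) \mid 0 < t_{123}, t_{134}, t_{235};\ t_{134} \mid t_{235};\ (t_{124}, t_{125}) \in O(t_{134}, t_{235}, t_{123});\ t_{ijk}=0 \text{ otherwise}\}.$$ *)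

(* Defs.v *)
From HB Require Import structures.
From mathcomp Require Import all_boot all_order all_algebra all_fingroup.
From mathcomp Require Import boolp classical_sets.

Set Implicit Arguments.
Unset Strict Implicit.
Unset Printing Implicit Defensive.

Import GRing.Theory.

Declare Scope group_term_scope.
Delimit Scope group_term_scope with gterm.

Inductive group_term (X : Type) : Type :=
  | tgen of X
  | tone
  | tmul of group_term X & group_term X
  | tinv of group_term X.
Arguments tone {X}.
Bind Scope group_term_scope with group_term.

Notation "1" := (@tone _) : group_term_scope.
Notation "u * v" := (tmul u v) : group_term_scope.
Notation "u ^-1" := (tinv u) : group_term_scope.
Notation "[~ u , v ]" := (u^-1 * v^-1 * u * v)%gterm : group_term_scope.

Definition texpz (X : Type) (u : group_term X) (z : int) : group_term X :=
  match z with
  | Posz n => iter n (tmul u) 1%gterm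
  | Negz n => ((iter n.+1 (tmul u) 1)^-1)%gterm
  end.

Section Presentation.
Local Open Scope group_term_scope.
Variables (X : Type) (rels : group_term X -> group_term X -> Prop).

(** The least congruence on terms containing [rels] and the group axioms; it
    identifies two terms iff they agree in the free group on X modulo the
    normal closure of the elements u v^-1 with [rels u v]. *)
Inductive presented_eq : group_term X -> group_term X -> Prop :=
  | peq_rel u v : rels u v -> presented_eq u v
  | peq_refl u : presented_eq u u
  | peq_sym u v : presented_eq u v -> presented_eq v u
  | peq_trans u v w : presented_eq u v -> presented_eq v w -> presented_eq u w
  | peq_mul u u' v v' :
      presented_eq u u' -> presented_eq v v' -> presented_eq (u * v) (u' * v')
  | peq_inv u u' : presented_eq u u' -> presented_eq (u^-1) (u'^-1)
  | peq_mulA u v w : presented_eq (u * (v * w)) (u * v * w)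
  | peq_mul1 u : presented_eq (1 * u) u
  | peq_mulr1 u : presented_eq (u * 1) u
  | peq_mulV u : presented_eq (u^-1 * u) 1
  | peq_mulrV u : presented_eq (u * u^-1) 1.

Definition presented_eqb : rel (group_term X) :=
  fun u v => `[< presented_eq u v >].

Lemma presented_eqb_equiv : equiv_class_of presented_eqb.
Proof.
split=> [u|u v|v u w].
- exact/asboolP/peq_refl.
- by apply/asboolP/asboolP; exact: peq_sym.
- by move=> /asboolP uv /asboolP vw; apply/asboolP; exact: peq_trans vw.
Qed.

Canonical presented_equiv := EquivRelPack presented_eqb_equiv.

End Presentation.

HB.instance Definition _ X := gen_eqMixin (group_term X).
HB.instance Definition _ (X : Type) := gen_choiceMixin (group_term X).

Section PresentedGroup.
Variables (X : Type) (rels : group_term X -> group_term X -> Prop).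

Definition presented_group : Type := {eq_quot (presented_equiv rels)}%qT.

HB.instance Definition _ := Choice.on presented_group.

Definition pclass (u : group_term X) : presented_group :=
  (\pi_({eq_quot (presented_equiv rels)}) u)%qT.

Lemma pclassP u v : pclass u = pclass v <-> presented_eq rels u v.
Proof.
split=> [/eqquotP/asboolP //|uv]; exact/eqquotP/asboolP.
Qed.

Definition prepr (x : presented_group) : group_term X :=
  generic_quotient.repr (x : {eq_quot (presented_equiv rels)}%qT).

Lemma preprK : cancel prepr pclass.
Proof. exact: reprK. Qed.

Lemma pclassK u : presented_eq rels (prepr (pclass u)) u.
Proof. exact/pclassP/preprK. Qed.

Definition pmul x y := pclass (prepr x * prepr y).
Definition pinv x := pclass (prepr x)^-1.

Lemma pmulE u v : pmul (pclass u) (pclass v) = pclass (u * v).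
Proof. by apply/pclassP/peq_mul; exact: pclassK. Qed.

Lemma pinvE u : pinv (pclass u) = pclass u^-1.
Proof. by apply/pclassP/peq_inv; exact: pclassK. Qed.

Fact pmulA : associative pmul.
Proof.
move=> x y z; rewrite -(preprK x) -(preprK y) -(preprK z) !pmulE.
exact/pclassP/peq_mulA.
Qed.

Fact pmul1 : left_id (pclass 1) pmul.
Proof. by move=> x; rewrite -(preprK x) pmulE; exact/pclassP/peq_mul1. Qed.

Fact pmulr1 : right_id (pclass 1) pmul.
Proof. by move=> x; rewrite -(preprK x) pmulE; exact/pclassP/peq_mulr1. Qed.

Fact pmulV : left_inverse (pclass 1) pinv pmul.
Proof.
by move=> x; rewrite -(preprK x) pinvE pmulE; exact/pclassP/peq_mulV.
Qed.

Fact pmulrV : right_inverse (pclass 1) pinv pmul.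
Proof.
by move=> x; rewrite -(preprK x) pinvE pmulE; exact/pclassP/peq_mulrV.
Qed.

HB.instance Definition _ :=
  isGroup.Build presented_group pmulA pmul1 pmulr1 pmulV pmulrV.

End PresentedGroup.

(** Plain predicates are used here: the universe of [set] is too small for
    [set finGroupType]. *)
Definition iso_class (Q : finGroupType) : finGroupType -> Prop :=
  fun H => [set: H]%G \isog [set: Q]%G.

(** A finite quotient is taken up to isomorphism, as a finite homomorphic
    image. *)
Definition finite_quotient (G : groupType) (Q : finGroupType) : Prop :=
  exists f : {multiplicative G -> Q}, forall y, exists x, f x = y.

(** The set F(G), each isomorphism class being the predicate of its members. *)
Definition finite_quotient_classes (G : groupType) :
    (finGroupType -> Prop) -> Prop :=
  fun C => exists2 Q, finite_quotient G Q & C = iso_class Q.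

Definition is_index5 (x : nat * nat * nat) : bool :=
  let: (i, j, k) := x in [&& 1 <= i, i < j, j < k & k <= 5].

Definition index5 := {x : nat * nat * nat | is_index5 x}.

Definition Z5 := index5 -> int.

(** The entry t_ijk, extended by 0 outside 1 <= i < j < k <= 5. *)
Definition entry (t : Z5) (i j k : nat) : int :=
  if insub (i, j, k) is Some x then t x else 0%R.

(** The generator g_i for 1 <= i <= 5; i = 1 is the element 0 of 'I_5. *)
Definition g5 (i : nat) : group_term 'I_5 := tgen (inord i.-1).

Inductive G5_rels (t : Z5) : group_term 'I_5 -> group_term 'I_5 -> Prop :=
  G5_rel i j of 1 <= i & i < j & j <= 5 :
    G5_rels t [~ g5 j, g5 i]%gterm
      (\big[@tmul _/1%gterm]_(j.+1 <= k < 6) texpz (g5 k) (entry t i j k)).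

Definition G5 (t : Z5) : groupType := presented_group (G5_rels t).

Local Open Scope ring_scope.

(** Z_p as the inverse limit of the Z/p^n: the n-th residue is the canonical
    representative, and the compatibility condition forces it to lie between
    0 and p^n - 1. *)
Record padic_int (p : nat) (p_pr : prime p) : Type := PadicInt {
  residue : nat -> int;
  residue_compat : forall n, residue n = (residue n.+1 %% (p ^ n)%N%:Z)%Z
}.

Section PadicRing.
Variables (p : nat) (p_pr : prime p).
Local Notation Zp := (padic_int p_pr).
Local Notation q n := ((p ^ n)%N%:Z).

HB.instance Definition _ := gen_eqMixin Zp.
HB.instance Definition _ := gen_choiceMixin Zp.

Lemma padic_eq (x y : Zp) : residue x =1 residue y -> x = y.
Proof.
case: x y => [x xP] [y yP] /= /funext xy; case: _ / xy yP => yP.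
by congr PadicInt; exact: Prop_irrelevance.
Qed.

Lemma modz_compat (u v : int) n :
  (u = v %[mod q n.+1])%Z -> (u = v %[mod q n])%Z.
Proof.
move=> /eqP; rewrite eqz_mod_dvd => uv; apply/eqP; rewrite eqz_mod_dvd.
by apply: dvdz_trans uv; rewrite expnS PoszM dvdz_mull.
Qed.

Lemma residue_mod (x : Zp) n : (residue x n %% q n)%Z = residue x n.
Proof. by rewrite residue_compat modz_mod. Qed.

Lemma residueS (x : Zp) n : (residue x n.+1 = residue x n %[mod q n])%Z.
Proof. by rewrite residue_mod -residue_compat. Qed.

Definition padic_lim (f : nat -> int)
  (fP : forall n, (f n.+1 = f n %[mod q n])%Z) : Zp.
Proof.
exists (fun n => (f n %% q n)%Z) => n.
by rewrite -fP; apply: modz_compat; rewrite modz_mod.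
Defined.

Definition padic_of_int (z : int) : Zp := @padic_lim (fun=> z) (fun=> erefl).

Definition padic_opp (x : Zp) : Zp.
Proof.
apply: (@padic_lim (fun n => - residue x n)) => n.
by rewrite -modzNm residueS modzNm.
Defined.

Definition padic_add (x y : Zp) : Zp.
Proof.
apply: (@padic_lim (fun n => residue x n + residue y n)) => n.
by rewrite -modzDm !residueS modzDm.
Defined.

Definition padic_mul (x y : Zp) : Zp.
Proof.
apply: (@padic_lim (fun n => residue x n * residue y n)) => n.
by rewrite -modzMm !residueS modzMm.
Defined.

Fact padic_addA : associative padic_add.
Proof. by move=> x y z; apply: padic_eq => n /=; rewrite modzDmr modzDml addrA. Qed.

Fact padic_addC : commutative padic_add.
Proof. by move=> x y; apply: padic_eq => n /=; rewrite addrC. Qed.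

Fact padic_add0 : left_id (padic_of_int 0) padic_add.
Proof. by move=> x; apply: padic_eq => n /=; rewrite mod0z add0r residue_mod. Qed.

Fact padic_addN : left_inverse (padic_of_int 0) padic_opp padic_add.
Proof. by move=> x; apply: padic_eq => n /=; rewrite modzDml addNr. Qed.

HB.instance Definition _ :=
  GRing.isZmodule.Build Zp padic_addA padic_addC padic_add0 padic_addN.

Fact padic_mulA : associative padic_mul.
Proof. by move=> x y z; apply: padic_eq => n /=; rewrite modzMmr modzMml mulrA. Qed.

Fact padic_mulC : commutative padic_mul.
Proof. by move=> x y; apply: padic_eq => n /=; rewrite mulrC. Qed.

Fact padic_mul1 : left_id (padic_of_int 1) padic_mul.
Proof. by move=> x; apply: padic_eq => n /=; rewrite modzMml mul1r residue_mod. Qed.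

Fact padic_mulDl : left_distributive padic_mul padic_add.
Proof.
by move=> x y z; apply: padic_eq => n /=; rewrite modzMml modzDm mulrDl.
Qed.

Fact padic_1_neq0 : padic_of_int 1 != padic_of_int 0.
Proof.
apply/eqP => /(congr1 (fun x : Zp => residue x 1)) /=.
by rewrite mod0z expn1 modz_small // ltz_nat prime_gt1.
Qed.

HB.instance Definition _ :=
  GRing.Zmodule_isComNzRing.Build Zp
    padic_mulA padic_mulC padic_mul1 padic_mulDl padic_1_neq0.

Definition padic_unit : {pred Zp} := fun x => `[< exists y : Zp, y * x = 1 >].

Definition padic_inv (x : Zp) : Zp :=
  if pselect (exists y : Zp, y * x = 1) is left ex then sval (cid ex) else x.

Fact padic_mulV : {in padic_unit, left_inverse 1 padic_inv *%R}.
Proof.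
move=> x /asboolP ex; rewrite /padic_inv.
by case: pselect => // ex'; case: cid.
Qed.

Fact padic_unitP (x y : Zp) : y * x = 1 -> padic_unit x.
Proof. by move=> yx; apply/asboolP; exists y. Qed.

Fact padic_inv_out : {in [predC padic_unit], padic_inv =1 id}.
Proof.
move=> x /asboolP nex; rewrite /padic_inv.
by case: pselect.
Qed.

HB.instance Definition _ :=
  GRing.ComNzRing_hasMulInverse.Build Zp
    padic_mulV padic_unitP padic_inv_out.

End PadicRing.

Local Open Scope classical_set_scope.

Definition rdvd (R : comNzRingType) (d x : R) : Prop := exists c, x = d * c.

(** The entry at (ord0, ord_max) is a_12 in 1-based numbering. *)
Definition Dk (R : comUnitRingType) (k : int) : set 'M[R]_2 :=
  [set M | M \in unitmx /\ rdvd k%:~R (M ord0 ord_max)].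

Definition row2 (R : comUnitRingType) (x y : R) : 'rV[R]_2 :=
  \row_(j < 2) (if j == ord0 then x else y).

(** N_0^2 is viewed inside Z^2; the parameters are meant to be positive. *)
Definition Lset (a b c : int) : set (int * int) :=
  [set v | (0 <= v.1 < gcdz a c) && (0 <= v.2 < gcdz b c)].

Definition L_act (a b c : int) (v : int * int) (M : 'M[int]_2) : int * int :=
  let w := row2 v.1 v.2 *m M in
  ((w ord0 ord0 %% gcdz a c)%Z, (w ord0 ord_max %% gcdz b c)%Z).

Definition L_same_orbit (a b c : int) (v w : int * int) : Prop :=
  exists2 M, Dk (b %/ a)%Z M & L_act a b c v M = w.

Definition orbit_representatives (a b c : int) (S : set (int * int)) : Prop :=
  S `<=` Lset a b c /\
  forall v, Lset a b c v -> exists! w, S w /\ L_same_orbit a b c v w.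

Definition padic_same_orbit (p : nat) (p_pr : prime p) (k a b c : int)
    (v w : int * int) : Prop :=
  exists2 A : 'M[padic_int p_pr]_2, Dk k A &
    let u := row2 v.1%:~R v.2%:~R *m A in
    rdvd (gcdz a c)%:~R (u ord0 ord0 - w.1%:~R) /\
    rdvd (gcdz b c)%:~R (u ord0 ord_max - w.2%:~R).

(** The set T(2,1,2) for a choice O(a,b,c) of orbit representatives. *)
Definition T212 (O : int -> int -> int -> set (int * int)) : set Z5 :=
  [set t : Z5 |
    [/\ [/\ 0 < entry t 1 2 3, 0 < entry t 1 3 4 & 0 < entry t 2 3 5],
        (entry t 1 3 4 %| entry t 2 3 5)%Z,
        O (entry t 1 3 4) (entry t 2 3 5) (entry t 1 2 3)
          (entry t 1 2 4, entry t 1 2 5)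
      & forall x : index5,
          sval x \notin [:: (1, 2, 3); (1, 2, 4); (1, 2, 5);
                            (1, 3, 4); (2, 3, 5)]%N ->
          t x = 0]].

(* Main.v *)
From HB Require Import structures.
Require Import Defs.
From mathcomp Require Import boolp classical_sets.
From mathcomp Require Import all_boot all_order all_algebra all_fingroup.
From mathcomp Require Import commutator cyclic.
From mathcomp Require Import zify ring.

(** A finite quotient of G(t) is a finite group Q generated by five elements
    satisfying the relations of G(t). Write a = t_134, b = t_235 = k a,
    c = t_123, (x, y) = (t_124, t_125).

    If (x', y') M = (x, y) modulo (gcd(a, c), gcd(b, c)) for some matrix
    M = (al, k be; ga, de) whose determinant D is prime to |Q| -- by the Chinese
    remainder theorem this only needs p-adic matrices -- then
      h1 = g1^al g2^be g3^w,   h2 = g1^(k ga) g2^de g3^w',   h3 = g3^D g4^u g5^v,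
      h4 = g4^(D al) g5^(D k be),   h5 = g4^(D ga) g5^(D de)
    generate Q and satisfy the relations with (x, y) replaced by (x', y'): the
    exponents u, v and w, w' absorb the multiples of c and those of a, b.

    Conversely, let Q be generated in a polynomial group on (Z/N)^5 satisfying
    the relations for (a, b, c, x, y), N being divisible by a high power of all
    the parameters, and let h1, ..., h5 generate Q and satisfy the relations for
    (a', b', c', x', y'). Modulo a slightly smaller modulus, h3 has trivial g1-
    and g2-coordinates, h4 and h5 are central, and the determinant D of the g1-
    and g2-coordinates of h1, h2 is a unit. The third coordinate of [h2, h1]
    gives c' | c, and [h3, h1], [h3, h2] give a' | a and a' b' | a b, whence
    equality by symmetry; then the matrix E of the central coordinates of h4, h5
    has determinant D^3, lies in D_k, and satisfies (x', y') E = D (x, y). *)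

Set Implicit Arguments.
Unset Strict Implicit.
Unset Printing Implicit Defensive.

Import Order.TTheory GRing.Theory Num.Theory.

(** * Finite quotients of presented groups *)

Section FiniteQuotients.
Local Open Scope group_scope.

Section TermValue.
Variables (X : finType) (Q : finGroupType) (g : X -> Q).

Fixpoint term_value (u : group_term X) : Q :=
  match u with
  | tgen i => g i
  | tone => 1
  | tmul u v => term_value u * term_value v
  | tinv u => (term_value u)^-1
  end.

Lemma term_value_exp u (n : nat) :
  term_value (texpz u (Posz n)) = term_value u ^+ n.
Proof. by rewrite /=; elim: n => //= n ->; rewrite expgS. Qed.

Lemma term_value_gen u : term_value u \in <<[set g i | i : X]>>.
Proof.
elim: u => /= [i||u IHu v IHv|u IHu]; last 3 first.
- exact: group1.
- exact: groupM.
- by rewrite groupV.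
by apply/mem_gen/imset_f.
Qed.

Lemma gen_term_value y :
  y \in <<[set g i | i : X]>> -> exists u, term_value u = y.
Proof.
move=> yG; apply/asboolP.
pose S := [set y : Q | `[< exists u, term_value u = y >]].
suff /subsetP/(_ y yG) : <<[set g i | i : X]>> \subset S by rewrite inE.
have SP : group_set S.
  apply/group_setP; split=> [|z w]; rewrite !inE; first by apply/asboolP; exists tone.
  move=> /asboolP[u <-] /asboolP[v <-]; apply/asboolP; by exists (tmul u v).
rewrite (gen_subG _ (Group SP)); apply/subsetP => _ /imsetP[i _ ->].
by rewrite inE; apply/asboolP; exists (tgen i).
Qed.

Variable rels : group_term X -> group_term X -> Prop.

Lemma term_value_presented :
  (forall u v, rels u v -> term_value u = term_value v) ->
  forall u v, presented_eq rels u v -> term_value u = term_value v.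
Proof.
move=> relsP u v; elim=> //=.
- by move=> {}u v' {}v _ -> _.
- by move=> ? ? ? ? _ -> _ ->.
- by move=> ? ? _ ->.
- by move=> *; rewrite mulgA.
- by move=> *; rewrite mul1g.
- by move=> *; rewrite mulg1.
- by move=> *; rewrite mulVg.
- by move=> *; rewrite mulgV.
Qed.

End TermValue.

(** Von Dyck's theorem: a homomorphism from the presented group amounts to a choice of images of the
    generators satisfying the relations, and it is onto exactly when these images generate. *)
Lemma finite_quotient_presented (X : finType)
    (rels : group_term X -> group_term X -> Prop) (Q : finGroupType) :
  finite_quotient (presented_group rels) Q <->
  exists2 g : X -> Q, <<[set g i | i : X]>> = [set: Q] &
    forall u v, rels u v -> term_value g u = term_value g v.
Proof.
split=> [[f f_surj]|[g genQ relsP]].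
  pose g i := f (pclass rels (tgen i)).
  have f1 : f (pclass rels tone) = 1.
    apply: (mulgI (f (pclass rels tone))); rewrite -gmulfM [RHS]mulg1.
    by congr (f _); exact: mul1g.
  have fE u : f (pclass rels u) = term_value g u.
    elim: u => //= [u IHu v IHv|u IHu].
      by rewrite -IHu -IHv -gmulfM; congr (f _); rewrite -pmulE.
    apply/eqP; rewrite eq_sym eq_invg_mul -IHu -gmulfM -f1; apply/eqP.
    congr (f _); rewrite -pinvE; exact: mulgV.
  exists g => [|u v uv]; last first.
    by rewrite -!fE; congr (f _); apply/pclassP/peq_rel.
  apply/eqP; rewrite eqEsubset subsetT; apply/subsetP => y _.
  have [x <-] := f_surj y; rewrite -(preprK x) fE; exact: term_value_gen.
pose f (z : presented_group rels) := term_value g (prepr z).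
have fE u : f (pclass rels u) = term_value g u.
  exact: (term_value_presented relsP (pclassK rels u)).
have fM : {morph f : x y / x * y}.
  by move=> z w; rewrite -[in LHS](preprK z) -[in LHS](preprK w) [_ * _]pmulE fE.
pose HM := isMultiplicative.Build _ _ f fM.
exists (HB.pack f HM : {multiplicative presented_group rels -> Q}) => y.
have [|u uy] := gen_term_value (g := g) (y := y); first by rewrite genQ inE.
by exists (pclass rels u) => /=; rewrite fE.
Qed.

(** A relation [g_j, g_i] = w is written as g_j g_i = g_i g_j w, free of inverses, so that every
    multiplicative map carries it over. Natural exponents suffice since the entries of a member of
    T(2,1,2) are nonnegative. *)
Definition g5_rels (Q : finGroupType) (a b c x y : nat) (g1 g2 g3 g4 g5 : Q) :=
  [/\ g2 * g1 = g1 * g2 * (g3 ^+ c * g4 ^+ x * g5 ^+ y),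
      g3 * g1 = g1 * g3 * g4 ^+ a,
      g3 * g2 = g2 * g3 * g5 ^+ b,
      [/\ commute g4 g1, commute g4 g2 & commute g4 g3] &
      [/\ commute g5 g1, commute g5 g2, commute g5 g3 & commute g5 g4]].

Definition g5_quotient (a b c x y : nat) (Q : finGroupType) :=
  exists g1 g2 g3 g4 g5 : Q, g5_rels a b c x y g1 g2 g3 g4 g5 /\
    <<[set g1; g2; g3; g4; g5]>> = [set: Q].

Lemma finite_quotient_G5 (t : Z5) (a b c x y : nat) (Q : finGroupType) :
  entry t 1 2 3 = Posz c -> entry t 1 3 4 = Posz a -> entry t 2 3 5 = Posz b ->
  entry t 1 2 4 = Posz x -> entry t 1 2 5 = Posz y ->
  (forall i j k, (i, j, k) \notin [:: (1, 2, 3); (1, 2, 4); (1, 2, 5);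
                                      (1, 3, 4); (2, 3, 5)]%N ->
     entry t i j k = Posz 0) ->
  finite_quotient (G5 t) Q <-> g5_quotient a b c x y Q.
Proof.
move=> tc ta tb tx ty t0; rewrite /G5 finite_quotient_presented.
have valE (g : 'I_5 -> Q) i j :
    term_value g (\big[@tmul _/1%gterm]_(j.+1 <= k < 6) texpz (g5 k) (entry t i j k))
  = \prod_(j.+1 <= k < 6) term_value g (texpz (g5 k) (entry t i j k)).
  exact: (big_morph (term_value g)).
have commE (u v : Q) : u^-1 * v^-1 * u * v = commg u v by rewrite /commg /conjg !mulgA.
have imE (g : 'I_5 -> Q) : [set g i | i : 'I_5] =
    [set g (inord 0); g (inord 1); g (inord 2); g (inord 3); g (inord 4)].
  apply/setP=> z; apply/imsetP/idP => [[i _ ->]|]; last first.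
    by rewrite !inE -!orbA => /or4P[|||/orP[]] /eqP->; eexists.
  rewrite -(inord_val i).
  by case: i => [[|[|[|[|[|//]]]]] i5] /=; rewrite !inE eqxx ?orbT.
split=> [[g genQ relsP]|]; last first.
  move=> [g1 [g2 [g3 [g4 [h5 [[r21 r31 r32 [r41 r42 r43] [r51 r52 r53 r54]] genQ]]]]]].
  have comE (u v w : Q) : u * v = v * u * w -> commg u v = w.
    by move=> uv; apply: (mulgI (v * u)); rewrite -commgC.
  move/comE: r21 => r21; move/comE: r31 => r31; move/comE: r32 => r32.
  pose g (i : 'I_5) := nth 1 [:: g1; g2; g3; g4; h5] i.
  have gE k : (k < 5)%N -> g (inord k) = nth 1 [:: g1; g2; g3; g4; h5] k.
    by move=> k5; rewrite /g inordK.
  exists g; first by rewrite imE !gE.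
  move=> _ _ [i j i1 ij j5]; rewrite valE /= commE !gE ?prednK //; try lia.
  case: i i1 ij => [|[|[|[|[|i]]]]] // _; case: j j5 => [|[|[|[|[|[|j]]]]]] // _ _ /=;
    rewrite unlock /= ?tc ?ta ?tb ?tx ?ty ?t0 // ?term_value_exp /= ?gE //=;
    rewrite ?expg0 ?mulg1 ?mul1g //; try by apply/eqP/commgP.
  by rewrite r21 mulgA.
exists (g (inord 0)), (g (inord 1)), (g (inord 2)), (g (inord 3)), (g (inord 4)).
split; last by rewrite -imE.
have gR i j : (1 <= i)%N -> (i < j)%N -> (j <= 5)%N ->
    commg (g (inord j.-1)) (g (inord i.-1)) =
    \prod_(j.+1 <= k < 6) term_value g (texpz (g5 k) (entry t i j k)).
  by move=> i1 ij j5; rewrite -valE -commE -(relsP _ _ (G5_rel t i1 ij j5)).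
have r i j : (1 <= i)%N -> (i < j)%N -> (j <= 5)%N ->
    (forall k, (j < k)%N -> entry t i j k = Posz 0) ->
    commute (g (inord j.-1)) (g (inord i.-1)).
  move=> i1 ij j5 z; apply/commgP/eqP; rewrite gR //.
  by rewrite big_nat big1 // => k /andP[jk _]; rewrite z.
split; [| | | split | split]; last 7 first.
- by apply: (r 1%N 4%N) => // k ?; rewrite t0 // !inE !xpair_eqE; lia.
- by apply: (r 2%N 4%N) => // k ?; rewrite t0 // !inE !xpair_eqE; lia.
- by apply: (r 3%N 4%N) => // k ?; rewrite t0 // !inE !xpair_eqE; lia.
- by apply: (r 1%N 5%N) => // k ?; rewrite t0 // !inE !xpair_eqE; lia.
- by apply: (r 2%N 5%N) => // k ?; rewrite t0 // !inE !xpair_eqE; lia.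
- by apply: (r 3%N 5%N) => // k ?; rewrite t0 // !inE !xpair_eqE; lia.
- by apply: (r 4%N 5%N) => // k ?; rewrite t0 // !inE !xpair_eqE; lia.
- rewrite [LHS]commgC (gR 1 2)%N // unlock /= tc tx ty !term_value_exp /=.
  by rewrite mulg1 [X in _ * _ * X]mulgA.
- rewrite [LHS]commgC (gR 1 3)%N // unlock /= ta t0 // !term_value_exp /=.
  by rewrite !mulg1.
- rewrite [LHS]commgC (gR 2 3)%N // unlock /= tb t0 // !term_value_exp /=.
  by rewrite mulg1 mul1g.
Qed.

End FiniteQuotients.

(** * Orbits over the p-adic integers and modulo n *)

Section Orbits.
Local Open Scope ring_scope.

(** * Residues and units of the p-adic integers *)

Section PadicArithmetic.
Variables (p : nat) (p_pr : prime p).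
Local Notation Zp := (padic_int p_pr).
Local Notation q n := ((p ^ n)%N%:Z).

Lemma residueD (x y : Zp) n :
  (residue (x + y) n = residue x n + residue y n %[mod q n])%Z.
Proof. exact: modz_mod. Qed.

Lemma residueM (x y : Zp) n :
  (residue (x * y) n = residue x n * residue y n %[mod q n])%Z.
Proof. exact: modz_mod. Qed.

Lemma residueN (x : Zp) n : (residue (- x) n = - residue x n %[mod q n])%Z.
Proof. exact: modz_mod. Qed.

Lemma padic_intr (z : int) : z%:~R = padic_of_int p_pr z.
Proof.
have natE n : n%:R = padic_of_int p_pr n%:Z.
  elim: n => [//|n IHn]; rewrite mulrS IHn; apply: padic_eq => m /=.
  by rewrite modzDm; congr (_ %% _)%Z; lia.
case: z => n; first exact: natE.
rewrite NegzE mulrNz -pmulrn natE; apply: padic_eq => m /=.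
by rewrite modzNm.
Qed.

Lemma residue_intr (z : int) n : residue (z%:~R : Zp) n = (z %% q n)%Z.
Proof. by rewrite padic_intr. Qed.

(** Bezout coefficients invert z modulo each p^n; they are compatible because z can be cancelled
    modulo p^n, so their limit is the inverse of z in Z_p. *)
Lemma padic_intr_unit (z : int) : coprimez z p%:Z -> (z%:~R : Zp) \is a GRing.unit.
Proof.
move=> zp.
have zq n : coprimez z (q n) by rewrite coprimezE coprimeXr.
pose f n := (egcdz z (q n)).1.
have fP n : (f n * z = 1 %[mod q n])%Z.
  rewrite /f; case: egcdzP => u v /= uv _.
  move: (zq n); rewrite /coprimez -uv => /eqP /(canRL (addrK _)) ->.
  by rewrite -mulNr addrC modzMDl.
have f_compat n : (f n.+1 = f n %[mod q n])%Z.
  have fS : (f n.+1 * z = 1 %[mod q n])%Z by apply: modz_compat; exact: fP.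
  apply/eqP; rewrite eqz_mod_dvd -(@Gauss_dvdzl _ _ z); last first.
    by rewrite coprimez_sym.
  by rewrite mulrBl -eqz_mod_dvd; apply/eqP; rewrite fS fP.
apply/unitrP; exists (padic_lim p_pr f_compat).
suff e : padic_lim p_pr f_compat * z%:~R = 1 by split=> //; rewrite mulrC.
apply: padic_eq => n; rewrite -residue_mod residueM residue_intr /=.
by rewrite modzMm fP.
Qed.

Lemma coprimez_residue_unit (x : Zp) n :
  x \is a GRing.unit -> coprimez (residue x n) (q n).
Proof.
case/unitrP=> y [yx _].
have e : (residue y n * residue x n = 1 %[mod q n])%Z.
  by rewrite -residueM yx -[1]/(1%:~R) residue_intr modz_mod.
apply/coprimezP.
move/eqP: e; rewrite eqz_mod_dvd => /dvdzP[w e].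
by exists (residue y n, - w) => /=; rewrite mulNr -e; ring.
Qed.

End PadicArithmetic.

(** The terms in a, c and b, c stand for the multiples of gcd(a, c) and
    gcd(b, c), and the entry a_12 = k be is divisible by k. *)
Definition orbit_mod (n : nat) (k a b c : int) (v w : int * int) : Prop :=
  exists M : int * int * int * int, exists u u' : int * int,
    let: (al, be, ga, de) := M in
    [/\ coprimez n (al * de - k * be * ga),
        (n %| al * v.1 + ga * v.2 + a * u.1 + c * u.2 - w.1)%Z &
        (n %| k * be * v.1 + de * v.2 + b * u'.1 + c * u'.2 - w.2)%Z].

(** M is inverted modulo n by e times its adjugate, e being an inverse of the determinant; this
    keeps the shape (al, k be; ga, de). Since b = k a, the adjugate maps pairs in (a, b) to pairs in
    (a, b). *)
Lemma orbit_mod_sym n k a b c v w : b = k * a ->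
  orbit_mod n k a b c v w -> orbit_mod n k a b c w v.
Proof.
move=> -> [[[[al be] ga] de]] [[i j]] [[i' j']] /= [].
set D := al * de - _ => coD /dvdzP[r r1] /dvdzP[r' r2].
have /coprimezP[[z e] /= ez] := coD.
exists (e * de, - e * be, - e * ga, e * al).
(* Minus the inverse matrix applied to the old correction terms. *)
exists (e * (ga * k * i' - de * i), e * (ga * j' - de * j)).
exists (e * (be * i - al * i'), e * (k * be * j - al * j')).
split=> /=.
- have -> : e * de * (e * al) - k * (- e * be) * (- e * ga) = e * (e * D).
    by rewrite /D; ring.
  have coe : coprimez n (e * D).
    by apply/coprimezP; exists (z, 1) => /=; rewrite mul1r.
  by move: coe; rewrite !coprimezMr => /andP[-> ->].
- apply/dvdzP; exists (e * (ga * r' - de * r) - z * v.1).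
  have -> : w.1 = al * v.1 + ga * v.2 + a * i + c * j - r * n by rewrite -r1; ring.
  have -> : w.2 = k * be * v.1 + de * v.2 + k * a * i' + c * j' - r' * n.
    by rewrite -r2; ring.
  apply/eqP; rewrite -subr_eq0; apply/eqP.
  transitivity (v.1 * (z * n + e * D - 1)); first by rewrite /D; ring.
  by rewrite ez subrr mulr0.
- apply/dvdzP; exists (e * (k * be * r - al * r') - z * v.2).
  have -> : w.1 = al * v.1 + ga * v.2 + a * i + c * j - r * n by rewrite -r1; ring.
  have -> : w.2 = k * be * v.1 + de * v.2 + k * a * i' + c * j' - r' * n.
    by rewrite -r2; ring.
  apply/eqP; rewrite -subr_eq0; apply/eqP.
  transitivity (v.2 * (z * n + e * D - 1)); first by rewrite /D; ring.
  by rewrite ez subrr mulr0.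
Qed.

Lemma crt_lift (m n : nat) (x y : int) : coprime m n ->
  exists z t s : int, z = x + m%:Z * t /\ z = y + n%:Z * s.
Proof.
move=> mn; exists (zchinese m n x y).
have /eqP := zchinese_modl (m1 := m) (m2 := n) mn x y.
rewrite eqz_mod_dvd => /dvdzP[t e].
have /eqP := zchinese_modr (m1 := m) (m2 := n) mn x y.
rewrite eqz_mod_dvd => /dvdzP[s e'].
by exists t, s; rewrite [m%:Z * t]mulrC [n%:Z * s]mulrC -e -e'; split; ring.
Qed.

Lemma coprimez_congr (n : nat) (x y t : int) :
  y = x + n%:Z * t -> coprimez n x -> coprimez n y.
Proof.
move=> -> /coprimezP[[u v] /= uv]; apply/coprimezP; exists (u - v * t, v) => /=.
by rewrite -uv; ring.
Qed.

(** Matrix entries and correction terms are glued one by one by the Chinese remainder theorem; the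
    three conditions are polynomial in them, hence can be checked modulo m and modulo n. *)
Lemma orbit_mod_mul m n k a b c v w : coprime m n ->
  orbit_mod m k a b c v w -> orbit_mod n k a b c v w ->
  orbit_mod (m * n)%N k a b c v w.
Proof.
move=> mn [[[[al1 be1] ga1] de1]] [[i1 j1]] [[k1 l1]] /= [co1 /dvdzP[r1 e1] /dvdzP[r1' e1']].
move=> [[[[al2 be2] ga2] de2]] [[i2 j2]] [[k2 l2]] /= [co2 /dvdzP[r2 e2] /dvdzP[r2' e2']].
have [al [tal [sal [al1E al2E]]]] := crt_lift al1 al2 mn.
have [be [tbe [sbe [be1E be2E]]]] := crt_lift be1 be2 mn.
have [ga [tga [sga [ga1E ga2E]]]] := crt_lift ga1 ga2 mn.
have [de [tde [sde [de1E de2E]]]] := crt_lift de1 de2 mn.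
have [i [ti [si [i1E i2E]]]] := crt_lift i1 i2 mn.
have [j [tj [sj [j1E j2E]]]] := crt_lift j1 j2 mn.
have [f [tf [sf [f1E f2E]]]] := crt_lift k1 k2 mn.
have [l [tl [sl [l1E l2E]]]] := crt_lift l1 l2 mn.
exists (al, be, ga, de), (i, j), (f, l); split=> /=.
- rewrite PoszM coprimezMl; apply/andP; split.
    apply: coprimez_congr co1.
    (* The cofactor of m in the difference of the glued determinant and the first one. *)
    instantiate (1 := al1 * tde + de1 * tal + m%:Z * tal * tde
      - k * (be1 * tga + ga1 * tbe + m%:Z * tbe * tga)).
    by rewrite al1E be1E ga1E de1E; ring.
  apply: coprimez_congr co2.
  instantiate (1 := al2 * sde + de2 * sal + n%:Z * sal * sde
    - k * (be2 * sga + ga2 * sbe + n%:Z * sbe * sga)).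
  by rewrite al2E be2E ga2E de2E; ring.
- rewrite PoszM Gauss_dvdz //; apply/andP; split; apply/dvdzP.
    exists (r1 + tal * v.1 + tga * v.2 + a * ti + c * tj).
    by rewrite al1E ga1E i1E j1E !mulrDl -e1; ring.
  exists (r2 + sal * v.1 + sga * v.2 + a * si + c * sj).
  by rewrite al2E ga2E i2E j2E !mulrDl -e2; ring.
- rewrite PoszM Gauss_dvdz //; apply/andP; split; apply/dvdzP.
    exists (r1' + k * tbe * v.1 + tde * v.2 + b * tf + c * tl).
    by rewrite be1E de1E f1E l1E !mulrDl -e1'; ring.
  exists (r2' + k * sbe * v.1 + sde * v.2 + b * sf + c * sl).
  by rewrite be2E de2E f2E l2E !mulrDl -e2'; ring.
Qed.

(** Strong induction on n: the full p-part for the least prime divisor p is split off, and the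
    remaining factor is smaller and coprime to it. *)
Lemma orbit_mod_primes k a b c v w :
  (forall p e, prime p -> orbit_mod (p ^ e) k a b c v w) ->
  forall n, (0 < n)%N -> orbit_mod n k a b c v w.
Proof.
move=> Hp n; have [m] := ubnP n; elim: m n => // m IHm n; rewrite ltnS => nm n0.
(* The modulus 1 is obtained as 2^0. *)
have [n1|n1] := leqP n 1; first by have := Hp 2 0 isT; rewrite expn0 (_ : n = 1)%N //; lia.
have p_pr := pdiv_prime n1; set p := pdiv n in p_pr.
have pn : (1 < n`_p)%N.
  rewrite p_part -[1%N](expn0 p) ltn_exp2l ?prime_gt1 //.
  by rewrite logn_gt0 mem_primes p_pr n0 pdiv_dvd.
rewrite -(partnC p n0) p_part; apply: orbit_mod_mul.
- rewrite -p_part; exact: coprime_partC.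
- exact: Hp.
- apply: IHm; last exact: part_gt0.
  have := partnC p n0; have := part_gt0 p^' n; nia.
Qed.

(** * Passage between p-adic matrices and integral congruences *)

Section PadicOrbit.
Variables (p : nat) (p_pr : prime p).
Local Notation Zp := (padic_int p_pr).

Lemma det_mx22 (R : comNzRingType) (A : 'M[R]_2) :
  \det A = A ord0 ord0 * A ord_max ord_max - A ord0 ord_max * A ord_max ord0.
Proof.
rewrite (expand_det_row _ ord0) !big_ord_recl big_ord0 addr0 /cofactor.
rewrite !det_mx11 !mxE /= expr0 expr1 mul1r mulN1r mulrN.
by congr (A _ _ * A _ _ - A _ _ * A _ _); apply: val_inj.
Qed.

Lemma row2_mul (R : comUnitRingType) (x y : R) (A : 'M[R]_2) j :
  (row2 x y *m A) ord0 j = x * A ord0 j + y * A ord_max j.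
Proof.
rewrite mxE !big_ord_recl big_ord0 addr0 !mxE /=.
by congr (_ + _ * A _ _); apply: val_inj.
Qed.

(** As a relation stable under the ring operations, it lets an identity in Z_p be reduced modulo p^n
    term by term. *)
Definition residue_is n (x : Zp) (z : int) : Prop :=
  (residue x n = z %[mod (p ^ n)%N%:Z])%Z.

Lemma residue_isP n x : residue_is n x (residue x n). Proof. by []. Qed.

Lemma residue_is_int n z : residue_is n z%:~R z.
Proof. by rewrite /residue_is residue_intr modz_mod. Qed.

Lemma residue_isD n x y z t :
  residue_is n x z -> residue_is n y t -> residue_is n (x + y) (z + t).
Proof. by rewrite /residue_is residueD => xz yt; rewrite -modzDm xz yt modzDm. Qed.

Lemma residue_isN n x z : residue_is n x z -> residue_is n (- x) (- z).
Proof. by rewrite /residue_is residueN => xz; rewrite -modzNm xz modzNm. Qed.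

Lemma residue_isM n x y z t :
  residue_is n x z -> residue_is n y t -> residue_is n (x * y) (z * t).
Proof. by rewrite /residue_is residueM => xz yt; rewrite -modzMm xz yt modzMm. Qed.

Lemma residue_is_dvd n z : residue_is n 0 z -> (((p ^ n)%N)%:Z %| z)%Z.
Proof.
have := residue_is_int n 0; rewrite /residue_is => -> /esym/eqP.
by rewrite eqz_mod_dvd subr0.
Qed.

Lemma padic_orbit_mod k a b c v w n :
  padic_same_orbit p_pr k a b c v w -> orbit_mod (p ^ n) k a b c v w.
Proof.
case=> A [A_unit [be A01]] /=; rewrite !row2_mul A01 => -[[r er] [s es]].
rewrite unitmxE det_mx22 A01 in A_unit.
have := coprimez_residue_unit n A_unit.
(* Bezout splits a multiple of gcd(a, c) into multiples of a and c, and likewise for gcd(b, c). *)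
have [[f1 [g1 e1]] [f2 [g2 e2]]] := (Bezoutz a c, Bezoutz b c).
pose R (x : Zp) := residue x n; have RP := @residue_isP n.
have RI := @residue_is_int n.
pose RM := @residue_isM n; pose RD := @residue_isD n; pose RN := @residue_isN n.
move=> co_det.
exists (R (A ord0 ord0), R be, R (A ord_max ord0), R (A ord_max ord_max)).
exists (- f1 * R r, - g1 * R r), (- f2 * R s, - g2 * R s); split=> /=.
- have /eqP := RD _ _ _ _ (RM _ _ _ _ (RP (A ord0 ord0)) (RP (A ord_max ord_max)))
    (RN _ _ (RM _ _ _ _ (RM _ _ _ _ (RI k) (RP be)) (RP (A ord_max ord0)))).
  rewrite eqz_mod_dvd => /dvdzP[z ez].
  rewrite coprimez_sym in co_det; apply: coprimez_congr co_det.
  by instantiate (1 := - z); rewrite mulrN [_ * z]mulrC -ez /R; ring.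
- apply: residue_is_dvd; rewrite [X in residue_is _ X](_ : _ =
    (A ord0 ord0 * v.1%:~R + A ord_max ord0 * v.2%:~R + - (w.1)%:~R)
     + - ((gcdz a c)%:~R * r)); last by rewrite -er; ring.
  have -> : R (A ord0 ord0) * v.1 + R (A ord_max ord0) * v.2 + a * (- f1 * R r) +
    c * (- g1 * R r) - w.1 =
    (R (A ord0 ord0) * v.1 + R (A ord_max ord0) * v.2 + - w.1) + - (gcdz a c * R r).
    by rewrite -e1; ring.
  by apply: (RD _ _ _ _ (RD _ _ _ _ (RD _ _ _ _ (RM _ _ _ _ _ _) (RM _ _ _ _ _ _))
    (RN _ _ _)) (RN _ _ (RM _ _ _ _ _ _))).
- apply: residue_is_dvd; rewrite [X in residue_is _ X](_ : _ =
    (k%:~R * be * v.1%:~R + A ord_max ord_max * v.2%:~R + - (w.2)%:~R)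
     + - ((gcdz b c)%:~R * s)); last by rewrite -es; ring.
  have -> : k * R be * v.1 + R (A ord_max ord_max) * v.2 + b * (- f2 * R s) +
    c * (- g2 * R s) - w.2 =
    (k * R be * v.1 + R (A ord_max ord_max) * v.2 + - w.2) + - (gcdz b c * R s).
    by rewrite -e2; ring.
  by apply: (RD _ _ _ _ (RD _ _ _ _ (RD _ _ _ _ (RM _ _ _ _ (RM _ _ _ _ _ _) _)
    (RM _ _ _ _ _ _)) (RN _ _ _)) (RN _ _ (RM _ _ _ _ _ _))).
Qed.

(** The matrix is E / D with E = (e11, e12; e21, e22): D and det E are prime to p, hence units of
    Z_p, and dividing by a unit preserves the divisibilities. *)
Lemma padic_same_orbit_of_int k a b c v w (D e11 e12 e21 e22 : int) :
  coprimez D p%:Z -> coprimez (e11 * e22 - e12 * e21) p%:Z -> (k %| e12)%Z ->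
  (gcdz a c %| v.1 * e11 + v.2 * e21 - D * w.1)%Z ->
  (gcdz b c %| v.1 * e12 + v.2 * e22 - D * w.2)%Z ->
  padic_same_orbit p_pr k a b c v w.
Proof.
move=> /(@padic_intr_unit _ p_pr) D_unit /(@padic_intr_unit _ p_pr) det_unit.
move=> /dvdzP[f f12] /dvdzP[r er] /dvdzP[s es].
pose d : Zp := (D%:~R)^-1.
have dD : d * D%:~R = 1 by rewrite mulVr.
pose A : 'M[Zp]_2 := \matrix_(i, j) (d *
  (if i == ord0 then if j == ord0 then e11 else e12
   else if j == ord0 then e21 else e22)%:~R).
exists A.
  split; last by exists (d * f%:~R); rewrite mxE /= f12 intrM; ring.
  rewrite unitmxE det_mx22 !mxE /=.
  have -> : d * e11%:~R * (d * e22%:~R) - d * e12%:~R * (d * e21%:~R) =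
    d * d * (e11 * e22 - e12 * e21)%:~R by rewrite intrB !intrM; ring.
  by rewrite !unitrM det_unit !unitrV D_unit.
rewrite /= !row2_mul !mxE /=; split.
  exists (d * r%:~R); rewrite [RHS]mulrCA -intrM [gcdz _ _ * _]mulrC -er.
  by rewrite intrB intrD !intrM mulrBr [d * (D%:~R * _)]mulrA dD mul1r; ring.
exists (d * s%:~R); rewrite [RHS]mulrCA -intrM [gcdz _ _ * _]mulrC -es.
by rewrite intrB intrD !intrM mulrBr [d * (D%:~R * _)]mulrA dD mul1r; ring.
Qed.

End PadicOrbit.

End Orbits.

(** * Change of generators *)

Section ChangeOfGenerators.
Local Open Scope group_scope.

Lemma commute_exp_swap (Q : finGroupType) (u v z : Q) i j : u * v = v * u * z ->
  commute u z -> commute v z -> u ^+ i * v ^+ j = v ^+ j * u ^+ i * z ^+ (i * j).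
Proof.
move=> uv uz vz; have Ez : commg u v = z by apply: (mulgI (v * u)); rewrite -commgC.
by rewrite -Ez -commXXg ?Ez //; exact: commgC.
Qed.

(** * Collection of products into normal form *)

Section NormalForm.
Variables (Q : finGroupType) (a b c x y : nat) (g1 g2 g3 : Q) (cen : nat -> nat -> Q).
Hypotheses (r21 : g2 * g1 = g1 * g2 * (g3 ^+ c * cen x y))
  (r31 : g3 * g1 = g1 * g3 * cen a 0) (r32 : g3 * g2 = g2 * g3 * cen 0 b)
  (cenC : forall m n u, cen m n * u = u * cen m n)
  (cenM : forall m n m' n', cen m n * cen m' n' = cen (m + m') (n + n'))
  (cen0 : cen 0 0 = 1).

(** The factor g4^m4 g5^m5 is kept abstract as [cen], so that both central powers are moved and
    merged at once. *)
Definition monom (m1 m2 m3 m4 m5 : nat) : Q :=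
  g1 ^+ m1 * g2 ^+ m2 * g3 ^+ m3 * cen m4 m5.

Let cenX m n k : cen m n ^+ k = cen (m * k) (n * k).
Proof. by elim: k => [|k IHk]; rewrite ?muln0 // expgS IHk cenM !mulnS. Qed.

Let swap31 i j : g3 ^+ i * g1 ^+ j = g1 ^+ j * g3 ^+ i * cen (a * i * j) 0.
Proof.
rewrite (commute_exp_swap _ _ r31) ?cenX ?mul0n ?mulnA //; exact/commute_sym/cenC.
Qed.

Let swap32 i j : g3 ^+ i * g2 ^+ j = g2 ^+ j * g3 ^+ i * cen 0 (b * i * j).
Proof.
rewrite (commute_exp_swap _ _ r32) ?cenX ?mul0n ?mulnA //; exact/commute_sym/cenC.
Qed.

(** Each g2 passed by g1 leaves a g3^c, which is then collected past the factors g2 to its right;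
    these crossings add up to the binomial coefficient. *)
Let swap21_1 j : g2 ^+ j * g1 =
  g1 * g2 ^+ j * g3 ^+ (c * j) * cen (x * j) (b * c * 'C(j, 2) + y * j).
Proof.
elim: j => [|j IHj]; first by rewrite bin0n !muln0 !expg0 cen0 !mulg1 mul1g.
rewrite expgS -mulgA IHj !mulgA r21 -!mulgA.
rewrite [cen x y * _]cenC -!mulgA [g3 ^+ c * _]mulgA swap32 -!mulgA.
rewrite [cen 0 _ * _]cenC -!mulgA !cenM [g3 ^+ c * _]mulgA -expgD.
rewrite (_ : c + c * j = c * j.+1)%N; last lia.
by do 4!congr (_ * _); congr cen; rewrite ?binS ?bin1; lia.
Qed.

(** Induction on i with [swap21_1]: the power of g3 already present crosses each further g1, which
    puts the other binomial coefficient into the exponent of g4. *)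
Let swap21 j i : g2 ^+ j * g1 ^+ i = g1 ^+ i * g2 ^+ j * g3 ^+ (c * i * j) *
  cen (a * c * 'C(i, 2) * j + x * i * j) (b * c * i * 'C(j, 2) + y * i * j).
Proof.
elim: i => [|i IHi].
  by rewrite bin0n !muln0 !mul0n !expg0 cen0 !mulg1 mul1g.
rewrite [in LHS]expgSr mulgA IHi -[LHS]mulgA cenC -!mulgA.
rewrite [g3 ^+ _ * (g1 * _)]mulgA -[g1 in g3 ^+ _ * g1]expg1 swap31 expg1 -!mulgA.
rewrite [g2 ^+ j * (g1 * _)]mulgA swap21_1 -!mulgA.
rewrite [cen (x * j) _ * _]cenC -!mulgA !cenM [g3 ^+ _ * (g3 ^+ _ * _)]mulgA -expgD.
rewrite [g1 ^+ i * (g1 * _)]mulgA -expgSr.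
rewrite (_ : c * j + c * i * j = c * i.+1 * j)%N; last lia.
by do 3!congr (_ * _); congr cen; rewrite ?binS ?bin1; lia.
Qed.

Lemma monomM m1 m2 m3 m4 m5 n1 n2 n3 n4 n5 :
  monom m1 m2 m3 m4 m5 * monom n1 n2 n3 n4 n5 =
  monom (m1 + n1) (m2 + n2) (m3 + n3 + c * m2 * n1)
    (m4 + n4 + a * m3 * n1 + a * c * 'C(n1, 2) * m2 + x * m2 * n1)
    (m5 + n5 + b * m3 * n2 + b * c * n1 * 'C(m2, 2) + b * c * m2 * n1 * n2
       + y * m2 * n1).
Proof.
rewrite /monom -!mulgA [cen m4 m5 * _]cenC -!mulgA.
rewrite [g3 ^+ m3 * (g1 ^+ n1 * _)]mulgA swap31 -!mulgA.
rewrite [cen (a * _ * _) 0 * _]cenC -!mulgA !cenM.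
rewrite [g2 ^+ m2 * (g1 ^+ n1 * _)]mulgA swap21 -!mulgA.
rewrite [cen _ _ * (g3 ^+ m3 * _)]cenC -!mulgA !cenM.
rewrite [g3 ^+ m3 * (g2 ^+ n2 * _)]mulgA swap32 -!mulgA.
rewrite [cen 0 _ * (g3 ^+ n3 * _)]cenC -!mulgA !cenM.
rewrite [g3 ^+ (c * _ * _) * (g2 ^+ n2 * _)]mulgA swap32 -!mulgA.
rewrite [cen 0 _ * (g3 ^+ m3 * _)]cenC -!mulgA !cenM.
rewrite [g2 ^+ m2 * (g2 ^+ n2 * _)]mulgA -expgD.
rewrite [g1 ^+ m1 * (g1 ^+ n1 * _)]mulgA -expgD.
rewrite [g3 ^+ m3 * (g3 ^+ n3 * _)]mulgA -expgD.
rewrite [g3 ^+ (c * _ * _) * (g3 ^+ _ * _)]mulgA -expgD.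
rewrite (_ : c * n1 * m2 + (m3 + n3) = m3 + n3 + c * m2 * n1)%N; last lia.
by do 3!congr (_ * _); congr cen; nia.
Qed.

(** Powers of elements free of g1 and g2 are computed exactly; for the others only the exponents of
    g1 and g2 are recorded. *)
Lemma monom_exp m n1 n2 n3 n4 n5 : exists r3 r4 r5,
  monom n1 n2 n3 n4 n5 ^+ m = monom (m * n1) (m * n2) r3 r4 r5 /\
  (n1 = 0 -> n2 = 0 -> [/\ r3 = m * n3, r4 = m * n4 & r5 = m * n5])%N.
Proof.
elim: m => [|m [r3 [r4 [r5 [IHm IH0]]]]].
  by exists 0, 0, 0; split=> //; rewrite /monom !mul0n !expg0 cen0 !mulg1.
rewrite expgS IHm monomM -!mulSn; do 3!eexists; split; first by [].
by move=> n10 n20; have [-> -> ->] := IH0 n10 n20; rewrite n10 n20; split; nia.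
Qed.

End NormalForm.

(** * Exponents modulo the group order, and the new generators *)

Lemma natrep (n : nat) (z : int) : (0 < n)%N ->
  exists m : nat, exists t : int, (m%:Z = z + n%:Z * t)%R.
Proof.
move=> n0; exists `|(z %% n)%Z|%N, (- (z %/ n)%Z)%R.
rewrite gez0_abs ?modz_ge0 -?lt0n //.
by rewrite [X in (X + _)%R](divz_eq z n); ring.
Qed.

Lemma orbit_mod_nat (n : nat) (k a b c : int) (v w : int * int) : (0 < n)%N ->
  orbit_mod n k a b c v w ->
  exists al be ga de : nat, exists i j i' j' r r' : int,
    [/\ coprimez n (al%:Z * de%:Z - k * be%:Z * ga%:Z)%R,
        (w.1 = al%:Z * v.1 + ga%:Z * v.2 + a * i + c * j - r * n%:Z)%R &
        (w.2 = k * be%:Z * v.1 + de%:Z * v.2 + b * i' + c * j' - r' * n%:Z)%R].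
Proof.
move=> n0 [[[[al be] ga] de]] [[i j]] [[i' j']] /= [coD /dvdzP[r e1] /dvdzP[r' e2]].
have [al' [t1 E1]] := natrep al n0; have [be' [t2 E2]] := natrep be n0.
have [ga' [t3 E3]] := natrep ga n0; have [de' [t4 E4]] := natrep de n0.
exists al', be', ga', de', i, j, i', j'.
exists (r + t1 * v.1 + t3 * v.2)%R, (r' + k * t2 * v.1 + t4 * v.2)%R.
split.
- apply: coprimez_congr coD.
  instantiate (1 := (al * t4 + de * t1 + n%:Z * t1 * t4
    - k * (be * t3 + ga * t2 + n%:Z * t2 * t3))%R).
  by rewrite E1 E2 E3 E4; ring.
- by rewrite E1 E3 !mulrDl -e1; ring.
- by rewrite E2 E4 !mulrDl -e2; ring.
Qed.

Lemma expg_congr (Q : finGroupType) (u : Q) (i j : nat) (t : int) :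
  (i%:Z - j%:Z = #|Q|%:Z * t)%R -> u ^+ i = u ^+ j.
Proof.
move=> ij; have uQ : u ^+ #|Q| = 1.
  by have := expg_cardG (in_setT u); rewrite cardsT.
have /eqP : (i%:Z == j%:Z %[mod #|Q|%:Z])%Z.
  by rewrite eqz_mod_dvd ij; apply/dvdzP; exists t; rewrite mulrC.
by rewrite !modz_nat => -[ijQ]; rewrite -(expg_mod i uQ) ijQ expg_mod.
Qed.

Lemma g5_quotient_orbit (Q : finGroupType) (a k c x y x' y' : nat) :
  g5_quotient a (k * a) c x y Q ->
  orbit_mod #|Q| k a (k%:Z * a%:Z)%R c (Posz x', Posz y') (Posz x, Posz y) ->
  g5_quotient a (k * a) c x' y' Q.
Proof.
move=> [g1 [g2 [g3 [g4 [g5 [[r21 r31 r32 [r41 r42 r43] [r51 r52 r53 r54]] genQ]]]]]].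
have centralP z : commute z g1 -> commute z g2 -> commute z g3 ->
    commute z g4 -> commute z g5 -> forall u, commute z u.
  move=> z1 z2 z3 z4 z5 u.
  suff /subsetP sub : [set: Q] \subset 'C[z].
    exact/commute_sym/cent1P/sub/in_setT.
  rewrite -genQ gen_subG; apply/subsetP => w wE.
  by apply/cent1P/commute_sym; move: wE; rewrite !inE -!orbA => /or4P[|||/orP[]] /eqP->.
have g4C := centralP g4 r41 r42 r43 (commute_refl _) (commute_sym r54).
have g5C := centralP g5 r51 r52 r53 r54 (commute_refl _).
pose cen m n := g4 ^+ m * g5 ^+ n.
have cenC m n u : cen m n * u = u * cen m n.
  by apply/commute_sym/commuteM; apply/commuteX/commute_sym.
have cenM m n m' n' : cen m n * cen m' n' = cen (m + m') (n + n').
  rewrite /cen !expgD -!mulgA; congr (_ * _).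
  by rewrite mulgA (commuteX2 n m' (g5C g4)) !mulgA.
have cen0 : cen 0 0 = 1 by rewrite /cen !expg0 mulg1.
have R21 : g2 * g1 = g1 * g2 * (g3 ^+ c * cen x y) by rewrite r21 /cen !mulgA.
have R31 : g3 * g1 = g1 * g3 * cen a 0 by rewrite /cen expg0 mulg1.
have R32 : g3 * g2 = g2 * g3 * cen 0 (k * a)%N by rewrite /cen expg0 mul1g.
pose M := monom g1 g2 g3 cen.
have MM := monomM R21 R31 R32 cenC cenM cen0; rewrite -/M in MM.
have MX := monom_exp R21 R31 R32 cenC cenM cen0; rewrite -/M in MX.
have n0 : (0 < #|Q|)%N by rewrite -cardsT cardG_gt0.
(* From here on, the order n of Q enters only through the fact that exponents matter modulo n. *)
move: n0 (@expg_congr Q); move: #|Q| => n n0 econgr.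
have Mcongr m1 m2 m3 m4 m5 n1 n2 n3 n4 n5 t1 t2 t3 t4 t5 :
    (m1%:Z - n1%:Z = n%:Z * t1)%R -> (m2%:Z - n2%:Z = n%:Z * t2)%R ->
    (m3%:Z - n3%:Z = n%:Z * t3)%R -> (m4%:Z - n4%:Z = n%:Z * t4)%R ->
    (m5%:Z - n5%:Z = n%:Z * t5)%R -> M m1 m2 m3 m4 m5 = M n1 n2 n3 n4 n5.
  move=> e1 e2 e3 e4 e5; rewrite /M /monom /cen.
  by rewrite (econgr g1 _ _ _ e1) (econgr g2 _ _ _ e2) (econgr g3 _ _ _ e3)
    (econgr g4 _ _ _ e4) (econgr g5 _ _ _ e5).
move=> /(orbit_mod_nat n0) [al [be [ga [de [i [j [i' [j' [r [r' []]]]]]]]]]] /=.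
pose D0 := (al%:Z * de%:Z - k%:Z * be%:Z * ga%:Z)%R; rewrite -/D0.
move=> /coprimezP[[z e] /= ze] eX eY.
(* Exponents must be naturals, so all integers used are replaced by natural representatives; E
   inverts D modulo n. *)
have [D [tD eD]] := natrep D0 n0.
have [E [tE eE]] := natrep e n0.
have [u [tu eu]] := natrep (D%:Z * j)%R n0.
have [v [tv ev]] := natrep (D%:Z * j')%R n0.
(* Comparing the central coordinates in the relation for [h2, h1] and dividing by a and by b leaves
   the linear system w' al - w k ga = P, w' be - w de = P' modulo n. *)
pose P := (- (c%:Z * ('C(al, 2)%:Z * de%:Z - 'C(k * ga, 2)%:Z * be%:Z) + D0 * i))%R.
pose P' := (- (c%:Z * (al%:Z * 'C(de, 2)%:Z + de%:Z * al%:Z * be%:Z -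
  k%:Z * ga%:Z * 'C(be, 2)%:Z - be%:Z * k%:Z * ga%:Z * de%:Z) + D0 * i'))%R.
(* Cramer's rule for this system, with e in place of 1 / D0. *)
have [w' [tw' ew']] := natrep (e * (P * de%:Z - k%:Z * ga%:Z * P'))%R n0.
have [w [tw ew]] := natrep (e * (P * be%:Z - al%:Z * P'))%R n0.
pose h1 := M al be w 0 0; pose h2 := M (k * ga)%N de w' 0 0.
pose h3 := M 0 0 D u v.
pose h4 := M 0 0 0 (D * al)%N (D * (k * be))%N; pose h5 := M 0 0 0 (D * ga)%N (D * de)%N.
have M0 m m3 m4 m5 : M 0 0 m3 m4 m5 ^+ m = M 0 0 (m * m3)%N (m * m4)%N (m * m5)%N.
  by have [r3 [r4 [r5 [-> []//]]]] := MX m 0 0 m3 m4 m5; rewrite muln0 => -> -> ->.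
have cenE m4 m5 : M 0 0 0 m4 m5 = cen m4 m5 by rewrite /M /monom !expg0 !mul1g.
exists h1, h2, h3, h4, h5; split.
  split.
  - rewrite /h3 /h4 /h5 !M0 /h1 /h2 !MM !muln0.
    (* The explicit arguments are the quotients by n of the differences of the five coordinates. *)
    apply: (Mcongr _ _ _ _ _ _ _ _ _ _ 0%R 0%R (- c%:Z * tD)%R
      (a%:Z * (- z * P + tw' * al%:Z - tw * (k%:Z * ga%:Z)) - D0 * r - c%:Z * tD * j
        - c%:Z * tu - tD * (x'%:Z * al%:Z + y'%:Z * ga%:Z))%R
      (k%:Z * a%:Z * (- z * P' + tw' * be%:Z - tw * de%:Z) - D0 * r' - c%:Z * tD * j'
        - c%:Z * tv - tD * (x'%:Z * k%:Z * be%:Z + y'%:Z * de%:Z))%R).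
    + by rewrite !PoszD ?PoszM; ring.
    + by rewrite !PoszD ?PoszM; ring.
    + by rewrite !PoszD !PoszM eD /D0; ring.
    + rewrite !PoszD !PoszM eu ew ew' eX eD.
      apply/eqP; rewrite -subr_eq0; apply/eqP.
      (* The two sides differ by a multiple of z n + e D0 - 1, which is zero. *)
      transitivity (a%:Z * P * (z * n%:Z + e * D0 - 1))%R; last by rewrite ze subrr mulr0.
      by rewrite /P /D0; ring.
    + rewrite !PoszD !PoszM ev ew ew' eY eD.
      apply/eqP; rewrite -subr_eq0; apply/eqP.
      transitivity (k%:Z * a%:Z * P' * (z * n%:Z + e * D0 - 1))%R;
        last by rewrite ze subrr mulr0.
      by rewrite /P' /D0; ring.
  - by rewrite /h4 M0 /h3 /h1 !MM !muln0 !mul0n; congr M; nia.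
  - by rewrite /h5 M0 /h3 /h2 !MM !muln0 !mul0n; congr M; nia.
  - by rewrite /h4 cenE; split; exact: cenC.
  - by rewrite /h5 cenE; split; exact: cenC.
pose K := <<[set h1; h2; h3; h4; h5]>>%G.
have [k1 k2 k3 k4 k5] : [/\ h1 \in K, h2 \in K, h3 \in K, h4 \in K & h5 \in K].
  by split; apply: mem_gen; rewrite !inE eqxx ?orbT.
(* As D E = 1 modulo n, q is a power of q^D. *)
have DK q : q ^+ D \in K -> q \in K.
  move=> qD; rewrite -[q]expg1 (econgr q 1%N (D * E)%N (z - D%:Z * tE - tD * e)%R).
    by rewrite expgM groupX.
  rewrite PoszM eE; apply/eqP; rewrite -subr_eq0; apply/eqP.
  transitivity (1 - (z * n%:Z + e * D0))%R; last by rewrite ze subrr.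
  by rewrite eD; ring.
have eq2 (q : Q) m m' t : (m%:Z - m'%:Z = D0 + n%:Z * t)%R -> q ^+ m * (q ^+ m')^-1 = q ^+ D.
  move=> mm'; apply: (mulIg (q ^+ m')); rewrite mulgKV -expgD.
  apply: (econgr _ _ _ (t - tD)%R).
  by rewrite PoszD eD -[X in (X - _)%R](subrK (Posz m') (Posz m)) mm'; ring.
(* The adjugate of (al, k be; ga, de) expresses g4^(D D0) through h4 and h5, and D0 = D modulo n.
   The next step does the same for g5. *)
have k4' : g4 \in K.
  apply/DK/DK; rewrite -expgM.
  have -> : g4 ^+ (D * D) = h4 ^+ de * (h5 ^+ (k * be))^-1.
    apply: (mulIg (h5 ^+ (k * be))); rewrite mulgKV /h4 /h5 !M0 !muln0 !cenE /cen mulgA -expgD.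
    rewrite (_ : k * be * (D * de) = de * (D * (k * be)))%N; last nia.
    congr (_ * _); apply: (econgr _ _ _ (D%:Z * tD)%R).
    transitivity (D%:Z * (D%:Z - D0))%R; last by rewrite eD; ring.
    by rewrite !PoszD !PoszM /D0; ring.
  by rewrite groupM ?groupV ?groupX.
have k5' : g5 \in K.
  apply/DK/DK; rewrite -expgM.
  have -> : g5 ^+ (D * D) = h5 ^+ al * (h4 ^+ ga)^-1.
    apply: (mulIg (h4 ^+ ga)); rewrite mulgKV /h4 /h5 !M0 !muln0 !cenE.
    rewrite (_ : g5 ^+ (D * D) = cen 0 (D * D)%N); last by rewrite /cen expg0 mul1g.
    rewrite cenM /cen (_ : 0 + ga * (D * al) = al * (D * ga))%N; last nia.
    congr (_ * _); apply: (econgr _ _ _ (D%:Z * tD)%R).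
    transitivity (D%:Z * (D%:Z - D0))%R; last by rewrite eD; ring.
    by rewrite !PoszD !PoszM /D0; ring.
  by rewrite groupM ?groupV ?groupX.
have cenK m m' : cen m m' \in K by rewrite groupM ?groupX.
have k3' : g3 \in K.
  by apply: DK; move: k3; rewrite /h3 /M /monom !expg0 !mul1g groupMr.
have strip m1 m2 m3 m4 m5 : M m1 m2 m3 m4 m5 \in K -> g1 ^+ m1 * g2 ^+ m2 \in K.
  by rewrite /M /monom groupMr // groupMr // groupX.
have h1X m : g1 ^+ (m * al) * g2 ^+ (m * be) \in K.
  have [r3 [r4 [r5 [e1 _]]]] := MX m al be w 0 0.
  by apply: (strip _ _ r3 r4 r5); rewrite -e1 groupX.
have h2X m : g1 ^+ (m * (k * ga)) * g2 ^+ (m * de) \in K.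
  have [r3 [r4 [r5 [e1 _]]]] := MX m (k * ga)%N de w' 0 0.
  by apply: (strip _ _ r3 r4 r5); rewrite -e1 groupX.
(* Modulo factors already in K, h1^de and h2^be carry the same power of g2; it cancels in the
   quotient and leaves g1^D0. Then g2 is treated in the same way. *)
have k1' : g1 \in K.
  apply: DK; rewrite -(eq2 _ (de * al)%N (be * (k * ga))%N 0%R); last first.
    by rewrite !PoszM /D0; ring.
  have := groupM (h1X de) (groupVr (h2X be)).
  by rewrite invMg mulgA [(be * de)%N]mulnC mulgK.
have k2' : g2 \in K.
  apply: DK; rewrite -(eq2 _ (al * de)%N (k * ga * be)%N 0%R); last first.
    by rewrite !PoszM /D0; ring.
  have := groupM (groupVr (h1X (k * ga)%N)) (h2X al).
  rewrite invMg [(al * (k * ga))%N]mulnC -mulgA mulKg => kk.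
  by rewrite (commuteV (commuteX2 _ _ (commute_refl g2))).
apply/eqP; rewrite eqEsubset subsetT /= -genQ gen_subG; apply/subsetP => q.
by rewrite !inE -!orbA => /or4P[|||/orP[]] /eqP->.
Qed.

End ChangeOfGenerators.

(** * The model group *)

Local Open Scope ring_scope.

(** The element (u1, ..., u5) stands for g1^u1 g2^u2 g3^u3 g4^(u4/2) g5^(u5/2):
    halving the last two coordinates turns the binomial coefficients of the
    product formula [monomM] into polynomials that make sense over any ring. *)
Definition model (R : finComNzRingType) (a b c x y : nat) : Type :=
  (R * R * R * R * R)%type.

Section Model.
Variables (R : finComNzRingType) (a b c x y : nat).
Local Notation model := (model R a b c x y).

HB.instance Definition _ := Finite.copy model (R * R * R * R * R)%type.

Definition mk (u1 u2 u3 u4 u5 : R) : model := (u1, u2, u3, u4, u5).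

Definition model_mul (u v : model) : model :=
  let: (u1, u2, u3, u4, u5) := u in let: (v1, v2, v3, v4, v5) := v in
  mk (u1 + v1) (u2 + v2) (u3 + v3 + c%:R * u2 * v1)
    (u4 + v4 + 2 * a%:R * u3 * v1 + a%:R * c%:R * (v1 ^+ 2 - v1) * u2
       + 2 * x%:R * u2 * v1)
    (u5 + v5 + 2 * b%:R * u3 * v2 + b%:R * c%:R * v1 * (u2 ^+ 2 - u2)
       + 2 * b%:R * c%:R * u2 * v1 * v2 + 2 * y%:R * u2 * v1).

Definition model_inv (u : model) : model :=
  let: (u1, u2, u3, u4, u5) := u in
  mk (- u1) (- u2) (- u3 + c%:R * u1 * u2)
    (- u4 - (2 * a%:R * (- u3 + c%:R * u1 * u2) * u1
       - a%:R * c%:R * (u1 ^+ 2 - u1) * u2 - 2 * x%:R * u2 * u1))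
    (- u5 - (2 * b%:R * (- u3 + c%:R * u1 * u2) * u2 + b%:R * c%:R * u1 * (u2 ^+ 2 + u2)
       - 2 * b%:R * c%:R * u2 * u1 * u2 - 2 * y%:R * u2 * u1)).

Let eq_mk u1 u2 u3 u4 u5 v1 v2 v3 v4 v5 : u1 = v1 -> u2 = v2 -> u3 = v3 ->
  u4 = v4 -> u5 = v5 -> mk u1 u2 u3 u4 u5 = mk v1 v2 v3 v4 v5.
Proof. by move=> -> -> -> -> ->. Qed.

Fact model_mulA : associative model_mul.
Proof.
move=> [[[[u1 u2] u3] u4] u5] [[[[v1 v2] v3] v4] v5] [[[[w1 w2] w3] w4] w5] /=.
by apply: eq_mk; ring.
Qed.

Fact model_mul1 : left_id (mk 0 0 0 0 0) model_mul.
Proof. by move=> [[[[u1 u2] u3] u4] u5] /=; apply: eq_mk; ring. Qed.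

Fact model_mulV : left_inverse (mk 0 0 0 0 0) model_inv model_mul.
Proof. by move=> [[[[u1 u2] u3] u4] u5] /=; apply: eq_mk; ring. Qed.

HB.instance Definition _ :=
  Finite_isGroup.Build model model_mulA model_mul1 model_mulV.

Lemma mk_mul u1 u2 u3 u4 u5 v1 v2 v3 v4 v5 :
  (mk u1 u2 u3 u4 u5 * mk v1 v2 v3 v4 v5)%g =
  mk (u1 + v1) (u2 + v2) (u3 + v3 + c%:R * u2 * v1)
    (u4 + v4 + 2 * a%:R * u3 * v1 + a%:R * c%:R * (v1 ^+ 2 - v1) * u2
       + 2 * x%:R * u2 * v1)
    (u5 + v5 + 2 * b%:R * u3 * v2 + b%:R * c%:R * v1 * (u2 ^+ 2 - u2)
       + 2 * b%:R * c%:R * u2 * v1 * v2 + 2 * y%:R * u2 * v1).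
Proof. by []. Qed.

Lemma mk_central_exp u3 u4 u5 n :
  (mk 0 0 u3 u4 u5 ^+ n)%g = mk 0 0 (n%:R * u3) (n%:R * u4) (n%:R * u5).
Proof.
elim: n => [|n IHn]; first by rewrite !mul0r.
by rewrite expgS IHn mk_mul; apply: eq_mk; ring.
Qed.

Lemma mk_exp12 (u : model) n :
  (u ^+ n)%g.1.1.1.1 = n%:R * u.1.1.1.1 /\ (u ^+ n)%g.1.1.1.2 = n%:R * u.1.1.1.2.
Proof.
elim: n => [|n [IH1 IH2]]; first by rewrite !mul0r.
rewrite expgS; move: u (u ^+ n)%g IH1 IH2.
by move=> [[[[u1 u2] u3] u4] u5] [[[[v1 v2] v3] v4] v5] /= -> ->; split; ring.
Qed.

(** A right factor (0, 0, w3, w4, w5) adds coordinatewise, so w is the difference of the coordinates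
    of u v and v u. *)
Lemma mk_commutator u1 u2 u3 u4 u5 v1 v2 v3 v4 v5 w3 w4 w5 :
  (mk u1 u2 u3 u4 u5 * mk v1 v2 v3 v4 v5)%g =
    (mk v1 v2 v3 v4 v5 * mk u1 u2 u3 u4 u5 * mk 0 0 w3 w4 w5)%g ->
  [/\ c%:R * (u2 * v1 - v2 * u1) = w3,
      2 * a%:R * (u3 * v1 - v3 * u1) +
        a%:R * c%:R * ((v1 ^+ 2 - v1) * u2 - (u1 ^+ 2 - u1) * v2) +
        2 * x%:R * (u2 * v1 - v2 * u1) = w4 &
      2 * b%:R * (u3 * v2 - v3 * u2) +
        b%:R * c%:R * (v1 * (u2 ^+ 2 - u2) - u1 * (v2 ^+ 2 - v2)
          + 2 * u2 * v2 * (v1 - u1)) +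
        2 * y%:R * (u2 * v1 - v2 * u1) = w5].
Proof.
rewrite !mk_mul => -[_ _ e3 e4 e5]; split; apply/eqP; rewrite -subr_eq0; apply/eqP.
- by rewrite -[RHS](subrr (u3 + v3 + c%:R * u2 * v1)) [X in _ = _ - X]e3; ring.
- rewrite -[RHS](subrr (u4 + v4 + 2 * a%:R * u3 * v1
    + a%:R * c%:R * (v1 ^+ 2 - v1) * u2 + 2 * x%:R * u2 * v1)) [X in _ = _ - X]e4; ring.
- rewrite -[RHS](subrr (u5 + v5 + 2 * b%:R * u3 * v2
    + b%:R * c%:R * v1 * (u2 ^+ 2 - u2)
    + 2 * b%:R * c%:R * u2 * v1 * v2 + 2 * y%:R * u2 * v1)) [X in _ = _ - X]e5; ring.
Qed.

Definition model_gens : {set model} :=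
  [set mk 1 0 0 0 0; mk 0 1 0 0 0; mk 0 0 1 0 0; mk 0 0 0 2 0; mk 0 0 0 0 2].

Lemma model_rels : g5_rels a b c x y (mk 1 0 0 0 0) (mk 0 1 0 0 0)
  (mk 0 0 1 0 0) (mk 0 0 0 2 0) (mk 0 0 0 0 2).
Proof.
rewrite /g5_rels /commute !mk_central_exp !mk_mul.
by split; [| | | split | split]; apply: eq_mk; ring.
Qed.

(** Elements whose last two coordinates can be halved. The generators are of this kind, and products
    stay so when every r^2 - r is even. *)
Definition even45 : {set model} :=
  [set u : model | [exists e, u.1.2 == 2 * e] && [exists f, u.2 == 2 * f]].

Lemma even45_group_set :
  (forall r : R, exists s, r ^+ 2 - r = 2 * s) -> group_set even45.
Proof.
move=> sq; apply/group_setP; split.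
  by rewrite inE; apply/andP; split; apply/existsP; exists 0; rewrite mulr0.
move=> [[[[u1 u2] u3] u4] u5] [[[[v1 v2] v3] v4] v5]; rewrite !inE /=.
move=> /andP[/existsP[e /eqP->] /existsP[f /eqP->]].
move=> /andP[/existsP[e' /eqP->] /existsP[f' /eqP->]].
have [s es] := sq v1; have [s' es'] := sq u2; rewrite es es'.
apply/andP; split; apply/existsP.
  by exists (e + e' + a%:R * u3 * v1 + a%:R * c%:R * s * u2 + x%:R * u2 * v1); apply/eqP; ring.
exists (f + f' + b%:R * u3 * v2 + b%:R * c%:R * v1 * s' + b%:R * c%:R * u2 * v1 * v2
  + y%:R * u2 * v1); apply/eqP; ring.
Qed.

(** The first two coordinates are additive, so a linear form in them modulo l cuts out a subgroup.
    It excludes generators whose first two coordinates are dependent modulo a prime. *)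
Definition kernel12 (l : nat) (r1 r2 : R) : {set model} :=
  [set u : model | [exists s, r1 * u.1.1.1.1 + r2 * u.1.1.1.2 == l%:R * s]].

Lemma kernel12_group_set l r1 r2 : group_set (kernel12 l r1 r2).
Proof.
apply/group_setP; split.
  by rewrite inE; apply/existsP; exists 0; rewrite /= !mulr0 addr0.
move=> [[[[u1 u2] u3] u4] u5] [[[[v1 v2] v3] v4] v5]; rewrite !inE /=.
move=> /existsP[s /eqP es] /existsP[s' /eqP es']; apply/existsP; exists (s + s').
by apply/eqP; rewrite [RHS]mulrDr -es -es'; ring.
Qed.

End Model.

Definition map_model (R S : finComNzRingType) (f : R -> S) a b c x y
    (u : model R a b c x y) : model S a b c x y :=
  mk a b c x y (f u.1.1.1.1) (f u.1.1.1.2) (f u.1.1.2) (f u.1.2) (f u.2).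

Lemma map_modelM (R S : finComNzRingType) (f : {rmorphism R -> S}) a b c x y :
  {morph @map_model R S f a b c x y : u v / (u * v)%g}.
Proof.
move=> [[[[u1 u2] u3] u4] u5] [[[[v1 v2] v3] v4] v5].
rewrite /map_model /= !mk_mul.
by rewrite !(rmorphD, rmorphN, rmorphXn, rmorphM, rmorph_nat).
Qed.

(** * Moving relations and generators between groups *)

Section Transfer.
Local Open Scope group_scope.

Lemma g5_rels_morph (Q Q' : finGroupType) (f : Q -> Q') a b c x y g1 g2 g3 g4 g5 :
  {morph f : u v / u * v} -> g5_rels a b c x y g1 g2 g3 g4 g5 ->
  g5_rels a b c x y (f g1) (f g2) (f g3) (f g4) (f g5).
Proof.
move=> fM; have f1 : f 1 = 1 by apply: (mulgI (f 1)); rewrite -fM !mulg1.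
have fX u n : f (u ^+ n) = f u ^+ n by elim: n => // n IHn; rewrite !expgS fM IHn.
case=> r21 r31 r32 [r41 r42 r43] [r51 r52 r53 r54].
rewrite /g5_rels /commute -!fX -!fM.
by rewrite r21 r31 r32 r41 r42 r43 r51 r52 r53 r54.
Qed.

Lemma g5_rels_inj (Q Q' : finGroupType) (f : Q -> Q') a b c x y g1 g2 g3 g4 g5 :
  {morph f : u v / u * v} -> injective f ->
  g5_rels a b c x y (f g1) (f g2) (f g3) (f g4) (f g5) ->
  g5_rels a b c x y g1 g2 g3 g4 g5.
Proof.
move=> fM fI; have f1 : f 1 = 1 by apply: (mulgI (f 1)); rewrite -fM !mulg1.
have fX u n : f (u ^+ n) = f u ^+ n by elim: n => // n IHn; rewrite !expgS fM IHn.
rewrite /g5_rels /commute -!fX -!fM.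
case=> /fI r21 /fI r31 /fI r32 [/fI r41 /fI r42 /fI r43] [/fI r51 /fI r52 /fI r53 /fI r54].
by [].
Qed.

(** [g5_quotient] asks for generators of a whole group, so the inclusion is applied to the generated
    subgroup as a group of its own, and the result is carried back along [sgval]. *)
Lemma g5_quotient_subgroup (gT : finGroupType) (a b c x y a' b' c' x' y' : nat)
    (e1 e2 e3 e4 e5 : gT) :
  g5_rels a b c x y e1 e2 e3 e4 e5 ->
  (forall Q, g5_quotient a b c x y Q -> g5_quotient a' b' c' x' y' Q) ->
  exists h1 h2 h3 h4 h5 : gT, g5_rels a' b' c' x' y' h1 h2 h3 h4 h5 /\
    <<[set h1; h2; h3; h4; h5]>> = <<[set e1; e2; e3; e4; e5]>>.
Proof.
move=> eR; pose G := <<[set e1; e2; e3; e4; e5]>>%G => /(_ (subg_of G)) [].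
  have [i1 i2 i3 i4 i5] : [/\ e1 \in G, e2 \in G, e3 \in G, e4 \in G & e5 \in G].
    by split; apply: mem_gen; rewrite !inE eqxx ?orbT.
  exists (subg G e1), (subg G e2), (subg G e3), (subg G e4), (subg G e5); split.
    by apply: (g5_rels_inj (f := sgval)) => //; rewrite ?subgK //; exact: val_inj.
  apply/eqP; rewrite -subTset; apply/subsetP => u _.
  set T := (X in <<X>>).
  have : sgval u \in sgval @* <<T>>.
    have : sgval u \in G by exact: subgP.
    apply/subsetP; rewrite gen_subG; apply/subsetP => w.
    rewrite !inE -!orbA => wE; have wG : w \in G by apply: mem_gen; rewrite !inE -!orbA.
    rewrite -(@subgK _ G w wG); apply: mem_morphim; rewrite ?inE //; apply: mem_gen.
    by move: wE => /or4P[|||/orP[]] /eqP->; rewrite !inE eqxx ?orbT.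
  by case/morphimP => w _ wT /val_inj ->.
move=> h1 [h2 [h3 [h4 [h5 [hR genh]]]]].
exists (sgval h1), (sgval h2), (sgval h3), (sgval h4), (sgval h5).
split; first exact: g5_rels_morph hR.
have := congr1 (fun A => sgval @* A) genh; rewrite /= morphim_gen ?subsetT //.
rewrite -[X in _ = X -> _]/(sgval @* [subg G]) im_sgval => <-.
by congr <<_>>; rewrite !morphimU !morphim_set1 ?inE.
Qed.

End Transfer.

(** * Models over Z/N and their integral coordinates *)

Lemma Zp_reduction N K : (1 < N)%N -> (1 < K)%N -> (K %| N)%N ->
  {rmorphism 'Z_N -> 'Z_K}.
Proof.
move=> N1 K1 KN; pose f (z : 'Z_N) : 'Z_K := (z : nat)%:R.
have fnat m : f m%:R = m%:R.
  by rewrite /f val_Zp_nat // -Zp_nat_mod // modn_dvdm // Zp_nat_mod.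
have fB : zmod_morphism f.
  move=> u v; apply/esym/eqP; rewrite subr_eq -(natr_Zp (u - v)) -(natr_Zp v).
  by rewrite !fnat -natrD -fnat natrD !natr_Zp subrK.
have fM : monoid_morphism f.
  split=> [|u v]; first exact: (fnat 1%N).
  by rewrite -(natr_Zp u) -(natr_Zp v) -natrM !fnat natrM.
pose A := GRing.isZmodMorphism.Build _ _ f fB.
pose B := GRing.isMonoidMorphism.Build _ _ f fM.
exact: (HB.pack f A B : {rmorphism 'Z_N -> 'Z_K}).
Qed.

Lemma intr_Zp_eq0 K (z : int) : (1 < K)%N -> z%:~R = 0 :> 'Z_K <-> (K %| z)%Z.
Proof.
move=> K1; have KK : (Posz K)%:~R = 0 :> 'Z_K by rewrite -pmulrn pchar_Zp.
split=> [z0|/dvdzP[q ->]]; last by rewrite intrM KK mulr0.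
have [m em] : exists m : nat, (z %% K)%Z = Posz m.
  by exists `|(z %% K)%Z|%N; rewrite gez0_abs // modz_ge0 // -lt0n; lia.
have : (m%:R : 'Z_K) = 0.
  by move: z0; rewrite (divz_eq z K) em intrD intrM KK mulr0 add0r -pmulrn.
move=> /(congr1 (@nat_of_ord _)); rewrite val_Zp_nat // => m0.
apply/dvdz_mod0P; rewrite em; congr Posz; rewrite -(@modn_small m K) ?m0 //.
have := ltz_pmod z (d := K); rewrite em; lia.
Qed.

Lemma intr_Zp_surj N (u : 'Z_N) : exists z : int, u = z%:~R.
Proof. by exists (Posz (u : nat)); rewrite -[LHS]natr_Zp -pmulrn. Qed.

Lemma sqr_sub_even N (u : 'Z_N) : exists s, u ^+ 2 - u = 2 * s.
Proof.
exists ('C(u, 2))%:R; rewrite -[in LHS](natr_Zp u); move: (u : nat) => m.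
suff -> : (m%:R ^+ 2 : 'Z_N) = m%:R + 2 * ('C(m, 2))%:R by rewrite addrC addKr.
rewrite -natrX -natrM -natrD; congr _%:R.
by elim: m => // m IHm; rewrite binS bin1; nia.
Qed.

(** Here e and f are the true exponents of g4 and g5, of which the model stores the doubles. *)
Definition model_int (K a b c x y : nat) (p q r e f : int) : model 'Z_K a b c x y :=
  mk a b c x y p%:~R q%:~R r%:~R (2 * e%:~R) (2 * f%:~R).

Lemma model_lift (N a b c x y : nat) (u : model 'Z_N a b c x y) :
  u \in even45 'Z_N a b c x y ->
  exists p q r e f : int, u = model_int N a b c x y p q r e f.
Proof.
move: u => [[[[u1 u2] u3] u4] u5]; rewrite inE /=.
move=> /andP[/existsP[e /eqP->] /existsP[f /eqP->]].
have [p ->] := intr_Zp_surj u1; have [q ->] := intr_Zp_surj u2.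
have [r ->] := intr_Zp_surj u3; have [e' ->] := intr_Zp_surj e.
have [f' ->] := intr_Zp_surj f.
by exists p, q, r, e', f'.
Qed.

(** Every ring morphism preserves images of integers, so the reduction may stay opaque. *)
Lemma map_model_int (N K a b c x y : nat) (g : {rmorphism 'Z_N -> 'Z_K})
    (p q r e f : int) :
  map_model g (model_int N a b c x y p q r e f) = model_int K a b c x y p q r e f.
Proof. by rewrite /map_model /model_int /= !rmorphM !rmorph_int rmorph_nat. Qed.

(** The subgroup [kernel12] then contains (1, 0, 0, 0, 0) and (0, 1, 0, 0, 0), where the form takes
    the values t1 and t2. As l divides N, divisibility by l descends from Z/N to the integers. *)
Lemma model_generators (N a b c x y : nat) (l : nat) (t1 t2 : int)
    (h1 h2 h3 h4 h5 : model 'Z_N a b c x y) : (1 < N)%N -> (l %| N)%N ->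
  (<<[set h1; h2; h3; h4; h5]>> = <<model_gens 'Z_N a b c x y>>)%g ->
  (forall h, h \in [set h1; h2; h3; h4; h5] -> 
     h \in kernel12 a b c x y l t1%:~R t2%:~R) ->
  (l %| t1)%Z /\ (l %| t2)%Z.
Proof.
move=> N1 lN gen sub.
pose P := Group (kernel12_group_set a b c x y l (t1%:~R : 'Z_N) t2%:~R).
have /subsetP GP : (<<[set h1; h2; h3; h4; h5]>> \subset P)%g.
  by rewrite gen_subG; apply/subsetP.
have dvd (t : int) (s : 'Z_N) : t%:~R = l%:R * s -> (l %| t)%Z.
  have [z ->] := intr_Zp_surj s; rewrite pmulrn -intrM => /eqP.
  rewrite -subr_eq0 -intrB => /eqP/(intr_Zp_eq0 _ N1) Nt.
  have /dvdzP[q e] : (l %| t - l%:Z * z)%Z by apply: dvdz_trans Nt.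
  by apply/dvdzP; exists (q + z); rewrite mulrDl -e; ring.
have [k1 k2] : mk a b c x y 1 0 0 0 0 \in P /\ mk a b c x y 0 1 0 0 0 \in P.
  by split; apply: GP; rewrite gen mem_gen // /model_gens !inE eqxx ?orbT.
move: k1 k2; rewrite !inE /= => /existsP[s /eqP es] /existsP[s' /eqP es'].
move: es es'; rewrite !mulr1 !mulr0 addr0 add0r => es es'.
by split; [exact: dvd es | exact: dvd es'].
Qed.

Lemma dvdz_of_Zp_eq K (z : int) (u v : 'Z_K) :
  (1 < K)%N -> u = v -> z%:~R = u - v -> (K %| z)%Z.
Proof. by move=> K1 -> e; apply/(intr_Zp_eq0 _ K1); rewrite e subrr. Qed.

Lemma mk_central_mul (R : finComNzRingType) a b c x y (u3 u4 u5 v3 v4 v5 : R) :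
  (mk a b c x y 0 0 u3 u4 u5 * mk a b c x y 0 0 v3 v4 v5)%g =
  mk a b c x y 0 0 (u3 + v3) (u4 + v4) (u5 + v5).
Proof. by rewrite mk_mul; congr mk; ring. Qed.

Lemma mk_commute (R : finComNzRingType) a b c x y (u3 u4 u5 v1 v2 v3 v4 v5 : R) :
  commute (mk a b c x y 0 0 u3 u4 u5) (mk a b c x y v1 v2 v3 v4 v5) ->
  2 * a%:R * (u3 * v1) = 0.
Proof.
rewrite /commute -[X in _ = X]mulg1 => /mk_commutator[_ e _].
by rewrite -[RHS]e; ring.
Qed.

Lemma common_prime (m n : nat) : (0 < m)%N -> ~~ coprime m n ->
  exists2 l, prime l & (l %| m)%N /\ (l %| n)%N.
Proof.
move=> m0 nco; have g1 : (1 < gcdn m n)%N.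
  by rewrite ltn_neqAle eq_sym nco gcdn_gt0 m0.
exists (pdiv (gcdn m n)); first exact: pdiv_prime.
by split; apply: (dvdn_trans (pdiv_dvd _)); [exact: dvdn_gcdl|exact: dvdn_gcdr].
Qed.

(* The coordinates of the generators are controlled only modulo K: dividing a
   congruence by one of the parameters costs a factor W of the modulus. *)
Lemma model_coords (a b c x y a' b' c' x' y' W K : nat) :
  (1 < K)%N -> (0 < W)%N -> (a' %| W)%N -> (b' %| W)%N -> (c' %| W)%N ->
  (forall Q, g5_quotient a b c x y Q -> g5_quotient a' b' c' x' y' Q) ->
  exists p1 q1 r1 p2 q2 r2 r3 e3 f3 r4 e4 f4 r5 e5 f5 : int,
  let D := q2 * p1 - q1 * p2 in
  [/\ coprimez K D,
    [/\ (K %| c%:Z * D - (c'%:Z * r3 + x'%:Z * r4 + y'%:Z * r5))%Z,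
        (K %| 2 * (a%:Z * (r2 * p1 - r1 * p2)) +
          a%:Z * (c%:Z * ((p1 ^+ 2 - p1) * q2 - (p2 ^+ 2 - p2) * q1)) +
          2 * (x%:Z * D) - 2 * (c'%:Z * e3 + x'%:Z * e4 + y'%:Z * e5))%Z &
        (K %| 2 * (b%:Z * (r2 * q1 - r1 * q2)) +
          b%:Z * (c%:Z * (p1 * (q2 ^+ 2 - q2) - p2 * (q1 ^+ 2 - q1)
            + 2 * q2 * q1 * (p1 - p2))) +
          2 * (y%:Z * D) - 2 * (c'%:Z * f3 + x'%:Z * f4 + y'%:Z * f5))%Z],
    [/\ (K %| 2 * (a%:Z * r3 * p1 - a'%:Z * e4))%Z,
        (K %| 2 * (b%:Z * r3 * q1 - a'%:Z * f4))%Z,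
        (K %| 2 * (a%:Z * r3 * p2 - b'%:Z * e5))%Z &
        (K %| 2 * (b%:Z * r3 * q2 - b'%:Z * f5))%Z],
    (K %| 2 * a%:Z * (r4 * p1))%Z /\ (K %| 2 * a%:Z * (r4 * p2))%Z &
    (K %| 2 * a%:Z * (r5 * p1))%Z /\ (K %| 2 * a%:Z * (r5 * p2))%Z].
Proof.
(* One factor W is spent on dividing by a' or b' in the coordinates of h4 and h5, the other on
   dividing by c' in those of h3. *)
move=> K1 W0 aW bW cW quot; pose N := (W * W * K)%N.
have N1 : (1 < N)%N by rewrite /N; nia.
have KN : (K %| N)%N by rewrite dvdn_mull.
have [h1 [h2 [h3 [h4 [h5 [hR gen]]]]]] :=
  g5_quotient_subgroup (model_rels 'Z_N a b c x y) quot.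
pose E := Group (even45_group_set a b c x y (@sqr_sub_even N)).
have /subsetP hE : ([set h1; h2; h3; h4; h5] \subset E).
  rewrite (subset_trans (subset_gen _)) // gen gen_subG; apply/subsetP => u.
  rewrite !inE -!orbA => /or4P[|||/orP[]] /eqP->; apply/andP; split; apply/existsP => /=;
    by [exists 0; rewrite mulr0 | exists 1; rewrite mulr1].
have hint u : u \in [set h1; h2; h3; h4; h5] ->
  exists p q r e f : int, u = model_int N a b c x y p q r e f.
  by move=> uh; apply/model_lift/hE.
have [p1 [q1 [r1 [e1 [f1 eh1]]]]] := hint h1 ltac:(by rewrite !inE eqxx ?orbT).
have [p2 [q2 [r2 [e2 [f2 eh2]]]]] := hint h2 ltac:(by rewrite !inE eqxx ?orbT).
have [p3 [q3 [r3 [e3 [f3 eh3]]]]] := hint h3 ltac:(by rewrite !inE eqxx ?orbT).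
have [p4 [q4 [r4 [e4 [f4 eh4]]]]] := hint h4 ltac:(by rewrite !inE eqxx ?orbT).
have [p5 [q5 [r5 [e5 [f5 eh5]]]]] := hint h5 ltac:(by rewrite !inE eqxx ?orbT).
rewrite {}eh1 {}eh2 {}eh3 {}eh4 {}eh5 in hR gen.
have cancel d K' v : (d %| W)%N -> ((W * K')%N %| d%:Z * v)%Z -> (K' %| v)%Z.
  move=> /dvdnP[w wd] /dvdzP[z ez]; apply/dvdzP; exists (z * w%:Z).
  apply: (mulfI (x := d%:Z)); first by apply/eqP; nia.
  by rewrite ez wd !PoszM; ring.
(* Commutators vanish in the first two coordinates, so there the relations read a' h4 = 0, b' h5 = 0
   and c' h3 + x' h4 + y' h5 = 0, additively. *)
have [[p4K q4K] [p5K q5K] [p3K q3K]] :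
  [/\ (K %| p4)%Z /\ (K %| q4)%Z, (K %| p5)%Z /\ (K %| q5)%Z &
      (K %| p3)%Z /\ (K %| q3)%Z].
  case: hR => R21 R31 R32 _ _.
  have M12 (u v : model 'Z_N a b c x y) :
      (u * v)%g.1.1.1.1 = u.1.1.1.1 + v.1.1.1.1 /\ (u * v)%g.1.1.1.2 = u.1.1.1.2 + v.1.1.1.2.
    by move: u v => [[[[? ?] ?] ?] ?] [[[[? ?] ?] ?] ?].
  have dvdN (z : int) (u v w : 'Z_N) : u + v = v + u + w -> z%:~R = w -> (N %| z)%Z.
    by rewrite [v + u]addrC -{1}[u + v]addr0 => /addrI <- /(intr_Zp_eq0 _ N1).
  have NW : N = (W * (W * K))%N by rewrite mulnA.
  have p4N : (N %| a'%:Z * p4)%Z.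
    have := congr1 (fun u => u.1.1.1.1) R31; rewrite /= !(M12 _ _).1 (mk_exp12 _ _).1 /=.
    by move/dvdN; apply; ring.
  have q4N : (N %| a'%:Z * q4)%Z.
    have := congr1 (fun u => u.1.1.1.2) R31; rewrite /= !(M12 _ _).2 (mk_exp12 _ _).2 /=.
    by move/dvdN; apply; ring.
  have p5N : (N %| b'%:Z * p5)%Z.
    have := congr1 (fun u => u.1.1.1.1) R32; rewrite /= !(M12 _ _).1 (mk_exp12 _ _).1 /=.
    by move/dvdN; apply; ring.
  have q5N : (N %| b'%:Z * q5)%Z.
    have := congr1 (fun u => u.1.1.1.2) R32; rewrite /= !(M12 _ _).2 (mk_exp12 _ _).2 /=.
    by move/dvdN; apply; ring.
  have p3N : (N %| c'%:Z * p3 + x'%:Z * p4 + y'%:Z * p5)%Z.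
    have := congr1 (fun u => u.1.1.1.1) R21; rewrite /= !(M12 _ _).1 !(mk_exp12 _ _).1 /=.
    by move/dvdN; apply; ring.
  have q3N : (N %| c'%:Z * q3 + x'%:Z * q4 + y'%:Z * q5)%Z.
    have := congr1 (fun u => u.1.1.1.2) R21; rewrite /= !(M12 _ _).2 !(mk_exp12 _ _).2 /=.
    by move/dvdN; apply; ring.
  rewrite NW in p4N q4N p5N q5N p3N q3N.
  move: p4N q4N p5N q5N => /(cancel _ _ _ aW) p4K /(cancel _ _ _ aW) q4K.
  move=> /(cancel _ _ _ bW) p5K /(cancel _ _ _ bW) q5K.
  have WKK z : ((W * K)%N %| z)%Z -> (K %| z)%Z.
    by apply: dvdz_trans; rewrite PoszM dvdz_mull.
  have WKN z : ((W * (W * K))%N %| z)%Z -> ((W * K)%N %| z)%Z.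
    by apply: dvdz_trans; rewrite [in X in (_ %| X)%Z]PoszM dvdz_mull.
  split; split; try exact: WKK; apply: (cancel _ _ _ cW).
    by move/WKN: p3N; rewrite -addrA rpredDr // rpredD // dvdz_mull.
  by move/WKN: q3N; rewrite -addrA rpredDr // rpredD // dvdz_mull.
pose g := Zp_reduction N1 K1 KN.
have p0 (z : int) : (K %| z)%Z -> z%:~R = 0 :> 'Z_K by move/(intr_Zp_eq0 _ K1).
have := g5_rels_morph (@map_modelM _ _ g a b c x y) hR; rewrite !map_model_int.
rewrite {3 4 5}/model_int.
rewrite (p0 _ p3K) (p0 _ q3K) (p0 _ p4K) (p0 _ q4K) (p0 _ p5K) (p0 _ q5K).
move=> -[R21 R31 R32 [R41 R42 _] [R51 R52 _ _]].
exists p1, q1, r1, p2, q2, r2, r3, e3, f3, r4, e4, f4, r5, e5, f5.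
move: R21 R31 R32; rewrite !mk_central_exp !mk_central_mul.
move=> /mk_commutator[A1 A2 A3] /mk_commutator[_ B1 B2] /mk_commutator[_ C1 C2].
split.
(* If a prime l divides K and D, the forms (q1, -p1) and (q2, -p2) vanish modulo l on all
   generators, so l divides p1 and p2. Then the form (1, 0) vanishes too, and l divides 1. *)
- rewrite coprimezE; apply/negPn/negP => nco.
  have [l l_pr [lK lD]] := common_prime (ltnW K1) nco.
  have lN : (l %| N)%N by exact: (dvdn_trans lK KN).
  have lz z : (K %| z)%Z -> (l %| z)%Z by apply: dvdz_trans.
  have ker t1 t2 : (l %| t1 * p1 + t2 * q1)%Z -> (l %| t1 * p2 + t2 * q2)%Z ->
      (l %| t1)%Z /\ (l %| t2)%Z.
    move=> l1 l2; apply: (model_generators N1 lN gen) => h hh.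
    have kerP p q r e f : (l %| t1 * p + t2 * q)%Z ->
        model_int N a b c x y p q r e f \in kernel12 a b c x y l t1%:~R t2%:~R.
      move=> /dvdzP[z ez]; rewrite inE /=; apply/existsP; exists z%:~R.
      by rewrite pmulrn -!intrM -intrD ez mulrC.
    move: hh; rewrite !in_setU !in_set1 -!orbA => /or4P[|||/orP[]] /eqP->; apply: kerP => //.
    + by rewrite rpredD // dvdz_mull // lz.
    + by rewrite rpredD // dvdz_mull // lz.
    + by rewrite rpredD // dvdz_mull // lz.
  have [_ l1] : (l %| q1)%Z /\ (l %| - p1)%Z.
    apply: ker; first by rewrite mulNr mulrC subrr dvdz0.
    by rewrite (_ : _ + _ = - (q2 * p1 - q1 * p2)) ?rpredN //; ring.
  have [_ l2] : (l %| q2)%Z /\ (l %| - p2)%Z.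
    apply: ker; last by rewrite mulNr mulrC subrr dvdz0.
    by rewrite (_ : _ + _ = q2 * p1 - q1 * p2) //; ring.
  have [] : (l %| 1)%Z /\ (l %| 0)%Z.
    by apply: ker; rewrite mul1r mul0r addr0 -[X in (_ %| X)%Z]opprK rpredN.
  by rewrite dvdz1 absz_nat => /eqP l1'; rewrite l1' in l_pr.
- split.
  + apply: (dvdz_of_Zp_eq K1 A1); ring.
  + apply: (dvdz_of_Zp_eq K1 A2); ring.
  + apply: (dvdz_of_Zp_eq K1 A3); ring.
- split.
  + apply: (dvdz_of_Zp_eq K1 B1); ring.
  + apply: (dvdz_of_Zp_eq K1 B2); ring.
  + apply: (dvdz_of_Zp_eq K1 C1); ring.
  + apply: (dvdz_of_Zp_eq K1 C2); ring.
- split; [apply: (dvdz_of_Zp_eq K1 (mk_commute R41)) |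
    apply: (dvdz_of_Zp_eq K1 (mk_commute R42))]; ring.
- split; [apply: (dvdz_of_Zp_eq K1 (mk_commute R51)) |
    apply: (dvdz_of_Zp_eq K1 (mk_commute R52))]; ring.
Qed.

(** * Recovering the invariants *)

Lemma sqr_sub_dvd2 (z : int) : (2 %| z ^+ 2 - z)%Z.
Proof.
(* The second divisibility covers negative z, as (-m)^2 - (-m) = m^2 + m. *)
suff H (n : nat) : (2 %| Posz n ^+ 2 - Posz n)%Z /\ (2 %| Posz n ^+ 2 + Posz n)%Z.
  case: z => n; first exact: (H n).1.
  by rewrite NegzE sqrrN opprK; exact: (H n.+1).2.
elim: n => [//|n [IH1 IH2]]; rewrite -addn1 PoszD.
have e : (2 %| 2 * Posz n)%Z by rewrite dvdz_mulr.
split; first by rewrite (_ : _ - _ = Posz n ^+ 2 + Posz n) //; ring.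
rewrite (_ : _ + _ = Posz n ^+ 2 + Posz n + 2 * (Posz n + 1)); last by ring.
by rewrite rpredD // dvdz_mulr.
Qed.

Lemma dvdz_cancel (W K : nat) (d v : int) : (0 < W)%N ->
  (d %| Posz W)%Z -> ((W * K)%N %| d * v)%Z -> (K %| v)%Z.
Proof.
move=> W0 /dvdzP[w wd] /dvdzP[z ez]; apply/dvdzP; exists (z * w).
apply: (mulfI (x := d)); first by apply/eqP => d0; move: wd; rewrite d0 mulr0; lia.
by rewrite ez PoszM wd; ring.
Qed.

(** [model_coords] is used with modulus W N: the spare W pays for cancelling 2 and 2 a. The terms r4
    and r5 vanish modulo N because h4 and h5 commute with h1 and h2. The shape of N allows one more
    division by a parameter, leaving W M. *)
Lemma model_congruences (a b c x y a' b' c' x' y' M : nat) :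
  let W := (2 * a * b * c * a' * b' * c')%N in
  (0 < W)%N -> (0 < M)%N ->
  (forall Q, g5_quotient a b c x y Q -> g5_quotient a' b' c' x' y' Q) ->
  exists p1 q1 p2 q2 r u v e3 f3 e4 f4 e5 f5 : int,
  let D := q2 * p1 - q1 * p2 in let N := Posz (W * (W * M)) in
  [/\ coprimez N D, (N %| c%:Z * D - c'%:Z * r)%Z,
    (N %| a%:Z * u + x%:Z * D - (c'%:Z * e3 + x'%:Z * e4 + y'%:Z * e5))%Z /\
    (N %| b%:Z * v + y%:Z * D - (c'%:Z * f3 + x'%:Z * f4 + y'%:Z * f5))%Z,
    (N %| a%:Z * r * p1 - a'%:Z * e4)%Z /\ (N %| b%:Z * r * q1 - a'%:Z * f4)%Z &
    (N %| a%:Z * r * p2 - b'%:Z * e5)%Z /\ (N %| b%:Z * r * q2 - b'%:Z * f5)%Z].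
Proof.
move=> W W0 M0 quot; set N := (W * (W * M))%N.
have [aW bW cW] : [/\ a' %| W, b' %| W & c' %| W]%N.
  by split; [apply/dvdn_mulr/dvdn_mulr|apply/dvdn_mulr|]; apply/dvdn_mull.
have W1 : (1 < W)%N by move: W0; rewrite /W -!mulnA; set u := (a * _)%N; lia.
have K1 : (1 < W * N)%N by rewrite /N; nia.
have [p1 [q1 [r1 [p2 [q2 [r2 [r3 [e3 [f3 [r4 [e4 [f4 [r5 [e5 [f5]]]]]]]]]]]]]]] :=
  model_coords K1 W0 aW bW cW quot.
set D := _ - _ => -[coD [A1 A2 A3] [B1 B2 C1 C2] [R41 R42] [R51 R52]].
have W2 : (2 %| Posz W)%Z by rewrite /W -!mulnA PoszM dvdz_mulr.
have Wa2 : (2 * a%:Z %| Posz W)%Z by rewrite /W -!mulnA mulnA PoszM dvdz_mulr.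
have NK z : ((W * N)%N %| z)%Z -> (N %| z)%Z.
  by apply: dvdz_trans; rewrite PoszM dvdz_mull.
have coND : coprimez N D.
  by apply: coprimez_dvdl coD; rewrite ?absz_nat dvdn_mull.
have r0 r : ((W * N)%N %| 2 * a%:Z * (r * p1))%Z ->
    ((W * N)%N %| 2 * a%:Z * (r * p2))%Z -> (N %| r)%Z.
  move=> /(dvdz_cancel W0 Wa2) n1 /(dvdz_cancel W0 Wa2) n2.
  (* The product r D is a combination of r p1 and r p2, and D is a unit modulo N. *)
  rewrite -(Gauss_dvdzl _ coND) (_ : r * D = q2 * (r * p1) - q1 * (r * p2)).
    by rewrite rpredB // dvdz_mull.
  by rewrite /D; ring.
have {R41 R42} r4N := r0 _ R41 R42; have {R51 R52} r5N := r0 _ R51 R52.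
have [s1 es1] : exists s, p1 ^+ 2 - p1 = 2 * s.
  by have /dvdzP[s ->] := sqr_sub_dvd2 p1; exists s; rewrite mulrC.
have [s2 es2] : exists s, p2 ^+ 2 - p2 = 2 * s.
  by have /dvdzP[s ->] := sqr_sub_dvd2 p2; exists s; rewrite mulrC.
have [t1 et1] : exists s, q1 ^+ 2 - q1 = 2 * s.
  by have /dvdzP[s ->] := sqr_sub_dvd2 q1; exists s; rewrite mulrC.
have [t2 et2] : exists s, q2 ^+ 2 - q2 = 2 * s.
  by have /dvdzP[s ->] := sqr_sub_dvd2 q2; exists s; rewrite mulrC.
exists p1, q1, p2, q2, r3.
(* Half the cofactors of a and of b in the two congruences for the central coordinates of
   [h2, h1]. *)
exists (r2 * p1 - r1 * p2 + c%:Z * (s1 * q2 - s2 * q1)).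
exists (r2 * q1 - r1 * q2 + c%:Z * (p1 * t2 - p2 * t1 + q2 * q1 * (p1 - p2))).
exists e3, f3, e4, f4, e5, f5; rewrite -/D /=; split=> //.
- move/NK: A1 => A1.
  rewrite (_ : _ - _ = (c%:Z * D - (c'%:Z * r3 + x'%:Z * r4 + y'%:Z * r5)) +
    (x'%:Z * r4 + y'%:Z * r5)); last by ring.
  by rewrite rpredD // rpredD // dvdz_mull.
- split; apply: (dvdz_cancel W0 W2).
    move: A2; rewrite es1 es2; congr (is_true (_ %| _)%Z); ring.
  move: A3; rewrite et1 et2; congr (is_true (_ %| _)%Z); ring.
- by split; apply: (dvdz_cancel W0 W2).
- by split; apply: (dvdz_cancel W0 W2).
Qed.

Section QuotientInvariants.
Variables (a b c x y a' b' c' x' y' : nat).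
Hypotheses (a0 : (0 < a)%N) (b0 : (0 < b)%N) (c0 : (0 < c)%N)
  (a'0 : (0 < a')%N) (b'0 : (0 < b')%N) (c'0 : (0 < c')%N).
Hypothesis quot :
  forall Q, g5_quotient a b c x y Q -> g5_quotient a' b' c' x' y' Q.

Let W := (2 * a * b * c * a' * b' * c')%N.
Let W0 : (0 < W)%N. Proof. by rewrite !muln_gt0 a0 b0 c0 a'0 b'0 c'0. Qed.

Let coprime_div (N d : nat) (D : int) : coprimez N D -> (d %| N)%N -> coprimez d D.
Proof. by move=> co dN; apply: coprimez_dvdl co. Qed.

Let WWM M d : (d %| W)%N -> (d %| W * (W * M))%N.
Proof. exact: dvdn_mulr. Qed.

Lemma quotient_dvd_c : (c' %| c)%N.
Proof.
have := @model_congruences a b c x y a' b' c' x' y' 1 W0 isT quot.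
rewrite -/W => -[p1 [q1 [p2 [q2 [r [u [v [e3 [f3 [e4 [f4 [e5 [f5]]]]]]]]]]]]] /=.
set D := _ - _ => -[coD A _ _ _].
have c'W : (c' %| W * (W * 1))%N by rewrite WWM // /W dvdn_mull.
have : (c' %| c%:Z * D)%Z.
  have c'A : (c' %| c%:Z * D - c'%:Z * r)%Z by apply: dvdz_trans A.
  by rewrite -(subrK (c'%:Z * r) (c%:Z * D)) rpredD // dvdz_mulr.
by rewrite Gauss_dvdzl //; apply: coprime_div coD c'W.
Qed.

Hypothesis (ab' : (a' %| b')%N) (cc' : c' = c).

(** Cancelling c' = c gives r = D modulo W, so r is a unit too. As a' divides b', it divides a r p1
    and a r p2, hence a r D. The product a' b' comes from a determinant. *)
Lemma quotient_dvd_ab : (a' %| a)%N /\ (a' * b' %| a * b)%N.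
Proof.
have := @model_congruences a b c x y a' b' c' x' y' 1 W0 isT quot.
rewrite -/W => -[p1 [q1 [p2 [q2 [r [u [v [e3 [f3 [e4 [f4 [e5 [f5]]]]]]]]]]]]] /=.
set D := _ - _ => -[coD A _ [B1 B2] [C1 C2]].
have cW : (c%:Z %| Posz W)%Z by rewrite dvdzE !absz_nat /W -cc' dvdn_mull.
have rD : ((W * 1)%N %| D - r)%Z.
  by apply: (dvdz_cancel W0 cW); rewrite mulrBr; rewrite cc' in A.
have cor : coprimez (W * 1)%N r.
  have coWD := coprime_div coD (dvdn_mull W (dvdnn (W * 1))).
  case/dvdzP: rD => z ez; apply: coprimez_congr coWD.
  by instantiate (1 := - z); rewrite -[LHS](subKr D) ez; ring.
have abW : (a' * b' %| W)%N.
  have -> : W = (2 * a * b * c * c' * (a' * b'))%N.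
    by rewrite /W mulnAC [X in (X * b')%N]mulnAC mulnA.
  exact/dvdn_mull.
have aW : (a' %| W)%N by apply: dvdn_trans abW; rewrite dvdn_mulr.
have co_d d : (d %| W)%N -> coprimez d (r * D).
  move=> dW; rewrite coprimezMr (coprime_div cor) ?muln1 //.
  by rewrite (coprime_div coD) // WWM.
split.
  have aN z : ((W * (W * 1))%N %| z)%Z -> (a' %| z)%Z.
    by apply: dvdz_trans; rewrite dvdzE !absz_nat WWM.
  have a1 : (a' %| a%:Z * r * p1)%Z.
    by rewrite -(subrK (a'%:Z * e4) (_ * p1)) rpredD //; [exact: aN|exact: dvdz_mulr].
  have a2 : (a' %| a%:Z * r * p2)%Z.
    by rewrite -(subrK (b'%:Z * e5) (_ * p2)) rpredD //; [exact: aN|exact: dvdz_mulr].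
  have : (a' %| a%:Z * (r * D))%Z.
    rewrite (_ : _ * _ = q2 * (a%:Z * r * p1) - q1 * (a%:Z * r * p2)).
      by rewrite rpredB // dvdz_mull.
    by rewrite /D; ring.
  by rewrite Gauss_dvdzl //; exact: co_d.
have abN z : ((W * (W * 1))%N %| z)%Z -> ((a' * b')%N %| z)%Z.
  by apply: dvdz_trans; rewrite dvdzE !absz_nat WWM.
(* The determinant of the four congruences: a' b' (e4 f5 - f4 e5) = a b r^2 D modulo N. The first
   four terms below are the errors. *)
have : ((a' * b')%N %| (a * b)%N%:Z * (r * (r * D)))%Z.
  have -> : (a * b)%N%:Z * (r * (r * D)) =
    (a%:Z * r * p1 - a'%:Z * e4) * (b%:Z * r * q2)
    + (b%:Z * r * q2 - b'%:Z * f5) * (a'%:Z * e4)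
    - (b%:Z * r * q1 - a'%:Z * f4) * (a%:Z * r * p2)
    - (a%:Z * r * p2 - b'%:Z * e5) * (a'%:Z * f4)
    + (a' * b')%N%:Z * (e4 * f5 - f4 * e5) by rewrite /D !PoszM; ring.
  apply: rpredD; last exact: dvdz_mulr.
  apply: rpredB; last exact/dvdz_mulr/abN.
  apply: rpredB; last exact/dvdz_mulr/abN.
  by apply: rpredD; exact/dvdz_mulr/abN.
rewrite Gauss_dvdzl //; have := co_d _ abW; rewrite !coprimezMr => /andP[-> ->].
by [].
Qed.

End QuotientInvariants.

(** The matrix is E = (e4, f4; e5, f5). Cancelling the parameters gives, modulo W M, e4 = r p1, f4 =
    k r q1, k e5 = r p2, f5 = r q2 and r = D, so det E = D^3; and k divides f4 since it divides W.
    The extra factor M allows units modulo any prescribed prime. *)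
Lemma quotient_matrix (a k c x y x' y' M : nat) :
  (0 < a)%N -> (0 < k)%N -> (0 < c)%N -> (0 < M)%N ->
  (forall Q, g5_quotient a (k * a) c x y Q -> g5_quotient a (k * a) c x' y' Q) ->
  exists D e11 e12 e21 e22 : int,
  [/\ coprimez D M, coprimez (e11 * e22 - e12 * e21) M, (k %| e12)%Z,
      (gcdz a c %| Posz x' * e11 + Posz y' * e21 - D * Posz x)%Z &
      (gcdz (k * a)%N c %| Posz x' * e12 + Posz y' * e22 - D * Posz y)%Z].
Proof.
move=> a0 k0 c0 M0 quot; pose W := (2 * a * (k * a) * c * a * (k * a) * c)%N.
have W0 : (0 < W)%N by rewrite !muln_gt0 a0 k0 c0.
have := @model_congruences a (k * a) c x y a (k * a) c x' y' M W0 M0 quot.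
rewrite -/W => -[p1 [q1 [p2 [q2 [r [u [v [e3 [f3 [e4 [f4 [e5 [f5]]]]]]]]]]]]] /=.
set D := _ - _ => -[coD A [T1 T2] [B1 B2] [C1 C2]].
have aW : (Posz a %| Posz W)%Z.
  by rewrite dvdzE !absz_nat; do 2!rewrite dvdn_mulr //; apply: dvdn_mull.
have bW : (Posz (k * a) %| Posz W)%Z by rewrite dvdzE !absz_nat dvdn_mulr // dvdn_mull.
have cW : (Posz c %| Posz W)%Z by rewrite dvdzE !absz_nat /W dvdn_mull.
have /dvdzP[z ez] : ((W * M)%N %| D - r)%Z.
  by apply: (dvdz_cancel W0 cW); rewrite mulrBr.
have /dvdzP[z1 ez1] : ((W * M)%N %| r * p1 - e4)%Z.
  by apply: (dvdz_cancel W0 aW); move: B1; congr (is_true (_ %| _)%Z); ring.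
have /dvdzP[z2 ez2] : ((W * M)%N %| k%:Z * r * q1 - f4)%Z.
  by apply: (dvdz_cancel W0 aW); move: B2; rewrite PoszM; congr (is_true (_ %| _)%Z); ring.
have /dvdzP[z3 ez3] : ((W * M)%N %| r * p2 - k%:Z * e5)%Z.
  by apply: (dvdz_cancel W0 aW); move: C1; rewrite PoszM; congr (is_true (_ %| _)%Z); ring.
have /dvdzP[z4 ez4] : ((W * M)%N %| r * q2 - f5)%Z.
  by apply: (dvdz_cancel W0 bW); move: C2; congr (is_true (_ %| _)%Z); ring.
have coM : coprimez M D.
  by apply: coprimez_dvdl coD; rewrite ?absz_nat mulnA dvdn_mull.
exists D, e4, f4, e5, f5; split.
- by rewrite coprimez_sym.
- rewrite coprimez_sym.
  have coD3 : coprimez M (D ^+ 3) by rewrite coprimezXr.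
  pose n := Posz (W * M).
  (* The explicit factor is the cofactor of M in det E - D^3. *)
  apply: coprimez_congr (_ : _ = _ + Posz M * (Posz W * (- z4 * r * p1 - z1 * r * q2
    + z1 * z4 * n + r * q1 * z3 + z2 * e5 - 2 * z * D ^+ 2 + z ^+ 2 * n * D))) coD3.
  have e4E : e4 = r * p1 - z1 * n by rewrite -ez1 subKr.
  have f4E : f4 = k%:Z * r * q1 - z2 * n by rewrite -ez2 subKr.
  have f5E : f5 = r * q2 - z4 * n by rewrite -ez4 subKr.
  have ke5 : k%:Z * e5 - (r * p2 - z3 * n) = 0 by rewrite -ez3 subKr subrr.
  have rE : r = D - z * n by rewrite -ez subKr.
  (* Only k e5 is known, not e5, so r q1 times the zero quantity of [ke5] is added to replace it. *)
  rewrite -[LHS]addr0 -(mulr0 (r * q1)) -ke5 e4E f4E f5E mulrA.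
  rewrite rE /D /n PoszM; ring.
- have kW : (k %| Posz (W * M))%Z.
    rewrite dvdzE !absz_nat; do 2!rewrite dvdn_mulr //; apply: dvdn_mull.
    exact: dvdn_mulr.
  rewrite -[f4](subKr (k%:Z * r * q1)) ez2.
  by apply: rpredB; [rewrite -mulrA; exact: dvdz_mulr|exact: dvdz_mull].
- have gN : (gcdz a c %| Posz (W * (W * M)))%Z.
    by rewrite PoszM; apply/dvdz_mulr/(dvdz_trans (dvdz_gcdl _ _) aW).
  rewrite (_ : _ - _ = a%:Z * u - c%:Z * e3 -
    (a%:Z * u + x%:Z * D - (c%:Z * e3 + x'%:Z * e4 + y'%:Z * e5))); last by ring.
  apply: rpredB; last exact: dvdz_trans gN _.
  by apply: rpredB; apply: dvdz_mulr; [exact: dvdz_gcdl|exact: dvdz_gcdr].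
- have gN : (gcdz (k * a)%N c %| Posz (W * (W * M)))%Z.
    by rewrite [Posz (W * _)]PoszM; apply/dvdz_mulr/(dvdz_trans (dvdz_gcdl _ _) bW).
  rewrite (_ : _ - _ = (k * a)%N%:Z * v - c%:Z * f3 -
    ((k * a)%N%:Z * v + y%:Z * D - (c%:Z * f3 + x'%:Z * f4 + y'%:Z * f5))); last by ring.
  apply: rpredB; last exact: dvdz_trans gN _.
  by apply: rpredB; apply: dvdz_mulr; [exact: dvdz_gcdl|exact: dvdz_gcdr].
Qed.

(** * From isomorphism classes of quotients to the equivalence *)

Lemma finite_quotient_isog (G : groupType) (Q Q' : finGroupType) :
  [set: Q] \isog [set: Q'] -> finite_quotient G Q -> finite_quotient G Q'.
Proof.
case/isogP => g _ gT [f f_surj].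
have gfM : {morph g \o f : u v / (u * v)%g}.
  by move=> u v /=; rewrite gmulfM morphM ?inE.
pose HM := isMultiplicative.Build _ _ (g \o f) gfM.
exists (HB.pack (g \o f) HM : {multiplicative G -> Q'}) => q.
have : q \in [set: Q'] by rewrite inE.
by rewrite -gT => /morphimP[q' _ _ ->]; have [u <-] := f_surj q'; exists u.
Qed.

Lemma finite_quotient_classes_eq (G H : groupType) :
  finite_quotient_classes G = finite_quotient_classes H <->
  forall Q, finite_quotient G Q <-> finite_quotient H Q.
Proof.
have sub (G1 G2 : groupType) Q : finite_quotient_classes G1 = finite_quotient_classes G2 ->
    finite_quotient G1 Q -> finite_quotient G2 Q.
  (* Q lies in its own class, so equality of the classes of Q and Q' makes them isomorphic. *)
  move=> GH GQ; have : finite_quotient_classes G1 (iso_class Q) by exists Q.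
  rewrite GH => -[Q' HQ' /(congr1 (fun C => C Q))]; rewrite /iso_class => QQ'.
  apply: finite_quotient_isog HQ'; rewrite isog_sym -QQ'; exact: isog_refl.
split=> [GH Q|GH]; first by split; apply: sub.
apply/funext => C; apply/propext.
by split=> -[Q /GH QG ->]; exists Q.
Qed.

(** Orbit representatives lie in L(a, b, c) and are thus nonnegative, so all parameters can be taken
    as naturals, with b = k a. *)
Lemma T212_params (O : int -> int -> int -> set (int * int)) (t : Z5) :
  (forall a b c : int, 0 < a -> 0 < b -> 0 < c -> (a %| b)%Z ->
     orbit_representatives a b c (O a b c)) ->
  T212 O t -> exists a k c x y : nat,
  [/\ [/\ (0 < a)%N, (0 < k)%N & (0 < c)%N],
     [/\ entry t 1 2 3 = Posz c, entry t 1 3 4 = Posz a & entry t 2 3 5 = Posz (k * a)],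
     (entry t 1 2 4 = Posz x /\ entry t 1 2 5 = Posz y) &
     forall Q, finite_quotient (G5 t) Q <-> g5_quotient a (k * a) c x y Q].
Proof.
move=> HO [[c0 a0 b0] ab Oxy t0].
have [x0 y0] : 0 <= entry t 1 2 4 /\ 0 <= entry t 1 2 5.
  have [sub _] := HO _ _ _ a0 b0 c0 ab.
  by have [/andP[x0 _] /andP[y0 _]] := andP (sub _ Oxy).
have absE (z : int) : 0 <= z -> z = Posz `|z|%N by move=> z0; rewrite gez0_abs.
have /dvdzP[k eb] := ab.
have k0 : 0 < k by move: b0; rewrite eb pmulr_lgt0.
have eb' : entry t 2 3 5 = Posz (`|k| * `|entry t 1 3 4|).
  by rewrite eb PoszM !gez0_abs // ltW.
exists `|entry t 1 3 4|%N, `|k|%N, `|entry t 1 2 3|%N, `|entry t 1 2 4|%N, `|entry t 1 2 5|%N.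
split; first by rewrite !absz_gt0 !gt_eqF.
- by rewrite -!absE // ltW.
- by rewrite -!absE.
move=> Q; apply: finite_quotient_G5; rewrite -?absE // ?ltW // => i j l ijl.
by rewrite /entry; case: insubP => // u _ uE; apply: t0; rewrite uE.
Qed.

Theorem theorem6
  (O : int -> int -> int -> set (int * int))
  (HO : forall a b c : int, 0 < a -> 0 < b -> 0 < c -> (a %| b)%Z ->
     orbit_representatives a b c (O a b c))
  (s t : Z5) (Hs : T212 O s) (Ht : T212 O t) :
  let k := (entry s 2 3 5 %/ entry s 1 3 4)%Z in
  finite_quotient_classes (G5 t) = finite_quotient_classes (G5 s) <->
  [/\ entry t 1 2 3 = entry s 1 2 3,
      entry t 1 3 4 = entry s 1 3 4 &
      entry t 2 3 5 = entry s 2 3 5] /\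
  (forall (p : nat) (p_pr : prime p),
     padic_same_orbit p_pr k
       (entry t 1 3 4) (entry t 2 3 5) (entry t 1 2 3)
       (entry t 1 2 4, entry t 1 2 5) (entry s 1 2 4, entry s 1 2 5)).
Proof.
move=> kk; rewrite finite_quotient_classes_eq {}/kk.
have [a [k [c [x [y [[a0 k0 c0] [-> -> ->] [-> ->] sQ]]]]]] := T212_params HO Hs.
have [a' [k' [c' [x' [y' [[a'0 k'0 c'0] [-> -> ->] [-> ->] tQ]]]]]] := T212_params HO Ht.
have -> : (Posz (k * a) %/ Posz a)%Z = k by rewrite PoszM mulzK // lt0n_neq0.
have b0 : (0 < k * a)%N by rewrite muln_gt0 k0.
have b'0 : (0 < k' * a')%N by rewrite muln_gt0 k'0.
split=> [ts|[[[ec] [ea] [eb]] orb] Q].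
  have st Q : g5_quotient a (k * a) c x y Q -> g5_quotient a' (k' * a') c' x' y' Q.
    by rewrite -sQ -tQ ts.
  have ts' Q : g5_quotient a' (k' * a') c' x' y' Q -> g5_quotient a (k * a) c x y Q.
    by rewrite -sQ -tQ ts.
  have ec : c' = c.
    apply/eqP; rewrite eqn_dvd (quotient_dvd_c a0 b0 c0 a'0 b'0 c'0 st).
    by rewrite (quotient_dvd_c a'0 b'0 c'0 a0 b0 c0 ts').
  have [d1 d2] := quotient_dvd_ab a0 b0 c0 a'0 b'0 c'0 st (dvdn_mull _ (dvdnn _)) ec.
  have [d1' d2'] :=
    quotient_dvd_ab a'0 b'0 c'0 a0 b0 c0 ts' (dvdn_mull _ (dvdnn _)) (esym ec).
  have ea : a' = a by apply/eqP; rewrite eqn_dvd d1.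
  (* Mutual divisibility gives a' b' = a b; with a' = a this becomes k' = k. *)
  have ek : k' = k.
    have : (a' * (k' * a') == a * (k * a))%N by rewrite eqn_dvd d2.
    by rewrite ea !(mulnC _ a) !eqn_pmul2l // => /eqP.
  subst c' a' k'; split=> // p p_pr.
  (* M = p suffices: an integral matrix whose determinant is prime to p is invertible over Z_p. *)
  have [D [e11 [e12 [e21 [e22 [coD coE kE g1 g2]]]]]] :=
    quotient_matrix a0 k0 c0 (prime_gt0 p_pr) st.
  exact: (@padic_same_orbit_of_int _ _ _ _ _ _ (_, _) (_, _) _ _ _ _ _ coD coE kE g1 g2).
subst c' a'; have ek : k' = k by move: eb => /eqP; rewrite eqn_pmul2r // => /eqP.
subst k'.
have Qn : (0 < #|Q|)%N by rewrite -cardsT cardG_gt0.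
(* The p-adic matrices give orbits modulo all prime powers, hence modulo the order of Q. The
   inclusion in the other direction uses the symmetry of the relation. *)
have orbQ : orbit_mod #|Q| k a (k%:Z * a%:Z) c (Posz x', Posz y') (Posz x, Posz y).
  by apply: orbit_mod_primes Qn => p e p_pr; apply: padic_orbit_mod; rewrite -PoszM.
rewrite sQ tQ; split=> gQ; apply: g5_quotient_orbit gQ _ => //.
exact: orbit_mod_sym orbQ.
Qed.
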